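(* Let $1<p<\infty$ and let $m:\mathbb{R}\to\mathbb{C}$ be a $(p,p)$ Fourier multiplier, continuous at $x=0$, with $\ell=m(0)\neq0$. Then $$c_p|\ell|\le|||m_+|||_{p,p}\le c_p|||m|||_{p,p}.\qquad(1)$$ Suppose also that $m$ is real-valued and even. Then $$c_p^{\mathbb{R}}|\ell|\le|||m_+|||_{p,p}^{\mathbb{R}}\le c_p^{\mathbb{R}}|||m|||_{p,p}.\qquad(2)$$ The four inequalities in (1) and (2) (those in (2) under the additional assumption that $m$ is real-valued and even) are equalities if $\hat m\in L^1(\mathbb{R})$ and $\hat m\ge0$.
   Context: For a function $m$ on $\mathbb{R}$ put $m_+(x)=m(x)\chi_{\{x>0\}}$. The Fourier transform is $\hat f(y)=\int_{\mathbb{R}}e^{-2\pi i xy}f(x)\,dx$ (understood in the sense of tempered distributions for $m$ merely bounded). For $m\in L^\infty(\mathbb{R},\mathbb{C})$ let $T_mf(x)=\int_{\mathbb{R}}e^{2\pi i xy}m(y)\hat f(y)\,dy$, initially defined for $f\in C_0^\infty(\mathbb{R})$; if $T_m$ extends to a bounded operator on $L^p(\mathbb{R})$, $m$ is called a $(p,p)$ Fourier multiplier. $|||m|||_{p,p}$ denotes the operator norm of $T_m$ acting on complex-valued functions $f\in L^p(\mathbb{R},\mathbb{C})$, and $|||m|||_{p,p}^{\mathbb{R}}$ denotes its operator norm when it acts on real-valued functions only, i.e. $\sup\|T_mf\|_p$ over real-valued $f$ with $\|f\|_p=1$ (where $T_mf$ may be complex-valued). With $s=\chi_{(0,\infty)}$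 the half-line multiplier on $\mathbb{R}$, $c_p=|||s|||_{p,p}$ and $c_p^{\mathbb{R}}=|||s|||_{p,p}^{\mathbb{R}}$. *)

(* Defs.v *)
From HB Require Import structures.
From mathcomp Require Import all_boot all_order all_algebra.
From mathcomp Require Import all_classical all_reals all_analysis.
From mathcomp Require Export complex.

Set Implicit Arguments.
Unset Strict Implicit.
Unset Printing Implicit Defensive.
Import Order.TTheory GRing.Theory Num.Theory.
Import numFieldNormedType.Exports.

Local Open Scope classical_set_scope.
Local Open Scope ring_scope.
Local Open Scope complex_scope.

Section fourier_multipliers.
Variable R : realType.
Local Notation C := R[i].
Local Notation mu := (@lebesgue_measure R).
Implicit Types (p : \bar R) (f g m : R -> C).

Definition ReF f (x : R) : R := complex.Re (f x).
Definition ImF f (x : R) : R := complex.Im (f x).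

(* [`|z|] lives in [R[i]]; this is the same number in [R]. *)
Definition modulus (z : C) : R := complex.Re `|z|.

Definition expi (t : R) : C := cos t +i* sin t.

Definition cmeasurable f :=
  measurable_fun [set: R] (ReF f) /\ measurable_fun [set: R] (ImF f).

Definition cintegral f : C :=
  (\int[mu]_x ReF f x) +i* (\int[mu]_x ImF f x).

Definition Lp_norm p f : \bar R :=
  Lnorm mu p (fun x => (modulus (f x))%:E).

Definition Lp p : set (R -> C) :=
  [set f | cmeasurable f /\ (Lp_norm p f < +oo)%E].

Definition real_valued f := forall x, complex.Im (f x) = 0.

Definition even_fun f := forall x, f (- x) = f x.

Definition smooth (u : R -> R) := forall n x, derivable (derive1n n u) x 1.

(* C_0^oo(R, C) *)
Definition test_fun : set (R -> C) :=
  [set f | [/\ smooth (ReF f), smooth (ImF f) &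
               compact (closure [set x | f x != 0])]].

Definition rapidly_decreasing (u : R -> R) :=
  forall k n : nat, exists M, forall x, `|x ^+ k * derive1n n u x| <= M.

Definition schwartz : set (R -> C) :=
  [set f | [/\ smooth (ReF f), smooth (ImF f),
               rapidly_decreasing (ReF f) & rapidly_decreasing (ImF f)]].

Definition fourier f (y : R) : C :=
  cintegral (fun x => expi (- (2 * pi * x * y)) * f x).

(* The tempered distribution [m^] is represented by the function [h]. *)
Definition fourier_is m (h : R -> C) :=
  forall phi, schwartz phi ->
    cintegral (fun y => m y * fourier phi y) =
    cintegral (fun y => h y * phi y).

Definition mult_op m f (x : R) : C :=
  cintegral (fun y => expi (2 * pi * x * y) * (m y * fourier f y)).

Definition bounded_extension (p : R) m (S : (R -> C) -> (R -> C)) :=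
  [/\ forall f, Lp p%:E f -> Lp p%:E (S f),
      forall (a : C) f g, Lp p%:E f -> Lp p%:E g ->
        {ae mu, forall x, S (fun t => a * f t + g t) x = a * S f x + S g x},
      exists K : R, forall f, Lp p%:E f ->
        (Lp_norm p%:E (S f) <= K%:E * Lp_norm p%:E f)%E &
      forall f, test_fun f -> {ae mu, forall x, S f x = mult_op m f x}].

Definition is_multiplier (p : R) m :=
  Lp +oo%E m /\ exists S, bounded_extension p m S.

(* The value at [f] of the extension of T_m to L^p by continuity is [g].
   When [m] is a (p,p) multiplier, [g] exists for every [f] in L^p and is
   unique up to a.e. equality, namely [S f] for the bounded extension [S].
   Integrability of |g|^p is deliberately not required: if T_m is not bounded
   on L^p then the norms below are [+oo]. *)
Definition mult_opLp (p : R) m f g :=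
  [/\ Lp p%:E f, cmeasurable g &
      exists f_ : nat -> R -> C,
        [/\ forall n, test_fun (f_ n),
            Lp_norm p%:E (fun x => f_ n x - f x) @[n --> \oo] --> 0%E &
            Lp_norm p%:E (fun x => mult_op m (f_ n) x - g x)
              @[n --> \oo] --> 0%E]].

Definition mult_norm (p : R) m : \bar R :=
  ereal_sup [set r | exists f g,
    [/\ mult_opLp p m f g, Lp_norm p%:E f = 1%E & r = Lp_norm p%:E g]].

Definition mult_normR (p : R) m : \bar R :=
  ereal_sup [set r | exists f g,
    [/\ real_valued f, mult_opLp p m f g, Lp_norm p%:E f = 1%E &
        r = Lp_norm p%:E g]].

Definition pos_part m (x : R) : C := if 0 < x then m x else 0.

Definition half_line : R -> C := fun x => (\1_(`]0, +oo[%classic : set R) x)%:C.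

Definition c_ (p : R) : \bar R := mult_norm p half_line.
Definition cR_ (p : R) : \bar R := mult_normR p half_line.

End fourier_multipliers.

(* Main.v *)
Require Import Defs.
From mathcomp Require Import all_boot all_order all_algebra.
From mathcomp Require Import all_classical all_reals all_analysis measurable_realfun ess_sup_inf.
From mathcomp Require Import ring lra.
Set Implicit Arguments.
Unset Strict Implicit.
Unset Printing Implicit Defensive.
Import Order.TTheory GRing.Theory Num.Theory.
Import numFieldNormedType.Exports.
Local Open Scope classical_set_scope.
Local Open Scope ring_scope.
Local Open Scope complex_scope.

(** The lower bounds come from dilations of the line, the upper bounds from
    composition of multipliers.

    Replacing [m] on a null set ([truncate]) one may assume that it is bounded
    everywhere. An operator bound on test functions is equivalent to a bound on
    the operator norm ([mult_norm_ge], [mult_norm_le] and their real versions);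
    the bounds are extended reals, so both sides may be infinite.

    Lower bounds. Dilations of the line are isometries up to a constant that
    cancels, and conjugate the multiplier of [m] into the multiplier of
    [y => m (e * y)]. As [e] tends to 0, [pos_part m (e * y)] tends to
    [m 0 * half_line y]; dominated convergence on the frequency side and Fatou's
    lemma on the space side ([dilation_limit_bound]) give
    [|m 0| c_p <= ||| m_+ |||]. Dilations preserve real functions, so the same
    holds for real norms.

    Upper bounds. The multiplier of [pos_part m] is that of [m] followed by that
    of [half_line]. The function [F = mult_op m f] is smooth
    ([has_moments_multiplier], [csmooth_inverse_fourier]) but not compactly
    supported, so the half-line bound is applied to [F t * chi (e * t)] with a
    bump [chi <= 1], whose norm is at most that of [F]. On the frequency side this
    smooths the half-line by the approximate identity [fourier chi (y / e) / e];
    it has mass [chi 0 = 1] by Fourier inversion at a point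
    ([fourier_inversion0], by Abel summation and the Poisson kernel), whence
    pointwise convergence ([cvg_half_line_cutoff]), and Fatou's lemma concludes
    ([pos_part_bound]). If [m] is real and even then [F] is real for real [f], so
    the real half-line bound applies.

    Equality. If [m] has an integrable transform [h >= 0], its operator is
    convolution with [h] up to a reflection, so Young's inequality bounds the
    norm of [m] by the integral of [h] ([nonnegative_transform_bound]). Testing
    the transform identity on wide bumps shows that this integral is [m 0]
    ([symbol_at_origin]). Then [||| m ||| <= |m 0|], and the upper bound meets the
    lower one. *)

(** * Complex numbers with real coordinates *)

Section complex_numbers.
Variable R : realType.
Local Notation C := R[i].
Local Notation Re := complex.Re.
Local Notation Im := complex.Im.
Implicit Types z w : C.

Lemma ReD z w : Re (z + w) = Re z + Re w. Proof. by case: z w => [a b] []. Qed.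
Lemma ImD z w : Im (z + w) = Im z + Im w. Proof. by case: z w => [a b] []. Qed.
Lemma ReN z : Re (- z) = - Re z. Proof. by case: z. Qed.
Lemma ImN z : Im (- z) = - Im z. Proof. by case: z. Qed.
Lemma ReM z w : Re (z * w) = Re z * Re w - Im z * Im w.
Proof. by case: z w => [a b] []. Qed.
Lemma ImM z w : Im (z * w) = Re z * Im w + Im z * Re w.
Proof. by case: z w => [a b] []. Qed.

Lemma complex_ext z w : Re z = Re w -> Im z = Im w -> z = w.
Proof. by case: z w => [a b] [c d] /= -> ->. Qed.

Lemma modulus_normc z : modulus z = Normc.normc z.
Proof. by case: z. Qed.

Lemma modulusE z : modulus z = Num.sqrt (Re z ^+ 2 + Im z ^+ 2).
Proof. by case: z. Qed.

Lemma modulus_ge0 z : 0 <= modulus z.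
Proof. by rewrite modulusE sqrtr_ge0. Qed.

Lemma modulusM z w : modulus (z * w) = modulus z * modulus w.
Proof. by rewrite !modulus_normc Normc.normcM. Qed.

Lemma modulusN z : modulus (- z) = modulus z.
Proof. by rewrite !modulusE ReN ImN !sqrrN. Qed.

Lemma ler_modulusD z w : modulus (z + w) <= modulus z + modulus w.
Proof. by rewrite !modulus_normc le_normcD. Qed.

Lemma modulus0 : modulus (0 : C) = 0.
Proof. by rewrite modulus_normc Normc.normc0. Qed.

Lemma modulus0_eq0 z : modulus z = 0 -> z = 0.
Proof. by rewrite modulus_normc => /Normc.eq0_normc. Qed.

Lemma modulus_real (x : R) : modulus x%:C = `|x|.
Proof. by rewrite modulusE /= expr0n addr0 sqrtr_sqr. Qed.

Lemma modulus_expi (t : R) : modulus (expi t) = 1.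
Proof. by rewrite modulusE /= cos2Dsin2 sqrtr1. Qed.

Lemma modulus_i : modulus ('i : C) = 1.
Proof. by rewrite modulusE /= expr0n expr1n add0r sqrtr1. Qed.

Lemma normr_Re_le z : `|Re z| <= modulus z.
Proof. by rewrite modulusE -sqrtr_sqr ler_wsqrtr// lerDl sqr_ge0. Qed.

Lemma normr_Im_le z : `|Im z| <= modulus z.
Proof. by rewrite modulusE -sqrtr_sqr ler_wsqrtr// lerDr sqr_ge0. Qed.

Lemma modulus_le_ReIm z : modulus z <= `|Re z| + `|Im z|.
Proof.
have -> : z = (Re z)%:C + 'i * (Im z)%:C.
  by apply: complex_ext; rewrite ?ReD ?ImD ?ReM ?ImM /=; lra.
apply: le_trans (ler_modulusD _ _) _.
by rewrite modulusM modulus_i mul1r !modulus_real ReD ImD ReM ImM /=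
  !(mul0r, mul1r, mulr0, subr0, addr0, add0r).
Qed.

Lemma expiD (s t : R) : expi (s + t) = expi s * expi t.
Proof.
by apply: complex_ext; rewrite ?ReM ?ImM /= ?cosD ?sinD; lra.
Qed.

(** Every complex number is turned onto the nonnegative half-line by a
    unimodular factor; this is what makes the triangle inequality for complex
    integrals sharp. *)
Lemma modulus_rotate z : exists2 u : C, modulus u = 1 & u * z = (modulus z)%:C.
Proof.
have [z0|z0] := eqVneq (modulus z) 0.
  exists 1; first by rewrite (modulus_real 1) normr1.
  by rewrite z0 mul1r (modulus0_eq0 z0).
have zz : Re z ^+ 2 + Im z ^+ 2 = modulus z ^+ 2.
  by rewrite modulusE sqr_sqrtr// addr_ge0 ?sqr_ge0.
exists ((Re z / modulus z) +i* (- Im z / modulus z)).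
  rewrite modulusE /= !exprMn sqrrN -mulrDl zz exprVn divff ?sqrtr1//.
  by rewrite expf_neq0.
by apply: complex_ext; rewrite ?ReM ?ImM /=;
  [rewrite -[RHS](mulfK z0) -expr2 -zz; field|field].
Qed.

(** Convergence is taken coordinatewise because the limits come out of real
    integrals, one for each coordinate. *)
Definition ccvg (u : nat -> C) (l : C) :=
  Re (u n) @[n --> \oo] --> Re l /\ Im (u n) @[n --> \oo] --> Im l.

Lemma ccvg_cst (l : C) : ccvg (fun=> l) l.
Proof. by split; exact: cvg_cst. Qed.

Lemma ccvgM u v l k : ccvg u l -> ccvg v k -> ccvg (fun n => u n * v n) (l * k).
Proof.
move=> [u1 u2] [v1 v2]; split.
  by under eq_fun do rewrite ReM; rewrite ReM; apply: cvgB; apply: cvgM.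
by under eq_fun do rewrite ImM; rewrite ImM; apply: cvgD; apply: cvgM.
Qed.

Lemma ccvg_modulus u l : ccvg u l -> modulus (u n) @[n --> \oo] --> modulus l.
Proof.
move=> [u1 u2]; under eq_fun do rewrite modulusE; rewrite modulusE.
apply: (@cvg_comp _ _ _ (fun n => Re (u n) ^+ 2 + Im (u n) ^+ 2) Num.sqrt).
  2: exact: sqrt_continuous.
by apply: cvgD; under eq_fun do rewrite expr2; rewrite expr2; apply: cvgM.
Qed.

Lemma ccvg_expi u (l : R) : u n @[n --> \oo] --> l ->
  ccvg (fun n => expi (u n)) (expi l).
Proof.
move=> ul; split; apply: (@cvg_comp _ _ _ u _ _ _ _ ul).
  exact: continuous_cos.
exact: continuous_sin.
Qed.

Lemma cvgC (u : nat -> R) (l : R) : u n @[n --> \oo] --> l -> ccvg (fun n => (u n)%:C) l%:C.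
Proof. by move=> ul; split => //=; exact: cvg_cst. Qed.

End complex_numbers.

(** * Affine changes of variable for Lebesgue measure *)

Section affine_change_of_variable.
Variable R : realType.
Local Notation mu := (@lebesgue_measure R).

Lemma measurable_affine (a b : R) : measurable_fun setT (fun x : R => a * x + b).
Proof. by apply: measurable_funD => //; apply: measurable_funM. Qed.

(** Both sides are measures that agree on half-open intervals, and a measure on
    the line is determined by its values there. *)
Lemma lebesgue_measure_affine (a b : R) (A : set R) : a != 0 -> measurable A ->
  mu A = (`|a|%:E * mu ((fun x => (a * x + b)%R) @^-1` A))%E.
Proof.
move=> a0 mA.
have k0 : 0 <= `|a| by [].
pose phi (x : measurableTypeR R) : measurableTypeR R := a * x + b.
have mphi : measurable_fun setT phi by exact: measurable_affine.
pose nu : {measure set (measurableTypeR R) -> \bar R} :=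
  mscale (NngNum k0)
    (measure_function_pushforward__canonical__measure_function_Measure mu mphi).
have -> : (`|a|%:E * mu ((fun x => (a * x + b)%R) @^-1` A))%E = nu A by [].
apply: (@lebesgue_measure_unique R nu) => // X [[c d] _ <-].
rewrite /= /nu /mscale /= /pushforward lebesgue_measure_itv /=.
have [an|ap|a00] := ltgtP a 0; last by rewrite a00 eqxx in a0.
- rewrite [X in mu X](_ : _ = `[((d - b) / a), ((c - b) / a)[%classic); last first.
    apply/seteqP; split => x /=; rewrite /phi !in_itv /= ler_ndivrMr// ltr_ndivlMr//;
      by move=> /andP[? ?]; apply/andP; split; lra.
  rewrite lebesgue_measure_itv /= !lte_fin ltr_ndivlMr// mulfVK ?lt_eqF//.
  rewrite ltrD2r; case: ifPn => _; last by rewrite mule0.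
  by rewrite -!EFinB -EFinM; congr EFin; rewrite ltr0_norm//; field; rewrite lt_eqF.
- rewrite [X in mu X](_ : _ = `]((c - b) / a), ((d - b) / a)]%classic); last first.
    apply/seteqP; split => x /=; rewrite /phi !in_itv /= ler_pdivlMr// ltr_pdivrMr//;
      by move=> /andP[? ?]; apply/andP; split; lra.
  rewrite lebesgue_measure_itv /= !lte_fin ltr_pdivrMr// mulfVK ?gt_eqF//.
  rewrite ltrD2r; case: ifPn => _; last by rewrite mule0.
  by rewrite -!EFinB -EFinM; congr EFin; rewrite gtr0_norm//; field; rewrite gt_eqF.
Qed.

Lemma ge0_integral_affine (a b : R) (f : R -> \bar R) : a != 0 ->
  measurable_fun setT f -> (forall x, 0 <= f x)%E ->
  (\int[mu]_x f x = `|a|%:E * \int[mu]_x f (a * x + b)%R)%E.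
Proof.
move=> a0 mf f0.
have k0 : 0 <= `|a| by [].
pose phi (x : measurableTypeR R) : measurableTypeR R := a * x + b.
have mphi : measurable_fun setT phi by exact: measurable_affine.
pose nu := measure_function_pushforward__canonical__measure_function_Measure mu mphi.
transitivity (\int[mscale (NngNum k0) nu]_x f x)%E.
  apply: eq_measure_integral => /= A mA _.
  exact: lebesgue_measure_affine.
rewrite ge0_integral_mscale//; congr (_ * _)%E.
by rewrite /nu ge0_integral_pushforward.
Qed.

Lemma integrable_affine (a b : R) (f : R -> \bar R) : a != 0 ->
  mu.-integrable setT f -> mu.-integrable setT (fun x => f (a * x + b)).
Proof.
move=> a0 /integrableP[mf fi]; apply/integrableP; split.
  by apply: (measurableT_comp mf); exact: measurable_affine.
move: fi; rewrite (@ge0_integral_affine a b)//; last exact: measurableT_comp.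
have : (0 <= \int[mu]_x `|f (a * x + b)%R|)%E by exact: integral_ge0.
case: (\int[mu]_x `|f (a * x + b)%R|)%E => [r _ _| _|]//; first exact: ltry.
by rewrite gt0_muley ?lte_fin ?normr_gt0.
Qed.

Lemma Rintegral_affine (a b : R) (f : R -> R) : a != 0 ->
  mu.-integrable setT (EFin \o f) ->
  \int[mu]_x f (a * x + b) = `|a|^-1 * \int[mu]_x f x.
Proof.
move=> a0 fi.
have [mf _] := integrableP _ _ _ fi.
have n0 : `|a| != 0 by rewrite normr_eq0.
have fia : mu.-integrable setT (fun x => (f (a * x + b))%:E).
  exact: (integrable_affine b a0 fi).
suff E : (\int[mu]_x (f x)%:E = `|a|%:E * \int[mu]_x (f (a * x + b))%:E)%E.
  rewrite /Rintegral E fineM//; last exact: integrable_fin_num.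
  by rewrite mulrA mulVf// mul1r.
rewrite integralE (ge0_integral_affine b a0 (measurable_funepos mf))//.
rewrite (ge0_integral_affine b a0 (measurable_funeneg mf))//.
rewrite -muleBr//; last first.
  apply: fin_num_adde_defl; rewrite fin_numN.
  rewrite [X in X \is a _](_ : _ = \int[mu]_x ((fun x => (f (a * x + b))%:E)^\-)%E x)%E.
    exact: (integrable_neg_fin_num measurableT fia).
  by apply: eq_integral => x _; rewrite !funenegE.
congr (_ * _)%E; rewrite [RHS]integralE; congr (_ - _)%E;
  by apply: eq_integral => x _; rewrite ?funenegE ?funeposE.
Qed.
End affine_change_of_variable.

(** * Integrals of complex functions *)

Section complex_integral.
Variable R : realType.
Local Notation C := R[i].
Local Notation Re := complex.Re.
Local Notation Im := complex.Im.
Local Notation mu := (@lebesgue_measure R).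
Implicit Types (f g : R -> C).

Definition cintegrable f :=
  mu.-integrable setT (EFin \o ReF f) /\ mu.-integrable setT (EFin \o ImF f).

Lemma cmeasurableM f g : cmeasurable f -> cmeasurable g ->
  cmeasurable (fun x => f x * g x).
Proof.
move=> [f1 f2] [g1 g2]; split; rewrite /ReF /ImF.
  under eq_fun do rewrite ReM.
  by apply: measurable_funB; apply: measurable_funM.
under eq_fun do rewrite ImM.
by apply: measurable_funD; apply: measurable_funM.
Qed.

Lemma cmeasurableD f g : cmeasurable f -> cmeasurable g ->
  cmeasurable (fun x => f x + g x).
Proof.
move=> [f1 f2] [g1 g2]; split; rewrite /ReF /ImF.
  by under eq_fun do rewrite ReD; apply: measurable_funD.
by under eq_fun do rewrite ImD; apply: measurable_funD.
Qed.

Lemma cmeasurable_cst (c : C) : cmeasurable (fun=> c).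
Proof. by split; exact: measurable_cst. Qed.

Lemma cmeasurableN f : cmeasurable f -> cmeasurable (fun x => - f x).
Proof.
move=> mf; have := cmeasurableM (cmeasurable_cst (- 1)) mf.
by under eq_fun do rewrite mulN1r.
Qed.

Lemma cmeasurable_real (u : R -> R) :
  measurable_fun setT u -> cmeasurable (fun x => (u x)%:C).
Proof. by move=> mu'; split => //; exact: measurable_cst. Qed.

Lemma cmeasurable_expi (u : R -> R) :
  measurable_fun setT u -> cmeasurable (fun x => expi (u x)).
Proof.
move=> mu'; split; rewrite /ReF /ImF /=; apply: measurableT_comp => //.
  by apply: continuous_measurable_fun; exact: continuous_cos.
by apply: continuous_measurable_fun; exact: continuous_sin.
Qed.

Lemma cmeasurable_affine (a b : R) f : cmeasurable f ->
  cmeasurable (fun x => f (a * x + b)).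
Proof.
by move=> [f1 f2]; split; [apply: (measurableT_comp f1)|apply: (measurableT_comp f2)];
  exact: measurable_affine.
Qed.

Lemma measurable_modulus d (T : measurableType d) (u : T -> C) :
  measurable_fun setT (fun x => Re (u x)) ->
  measurable_fun setT (fun x => Im (u x)) ->
  measurable_fun setT (fun x => modulus (u x)).
Proof.
move=> f1 f2; under eq_fun do rewrite modulusE.
apply: (measurableT_comp (f := @Num.sqrt R)).
  by apply: continuous_measurable_fun; exact: sqrt_continuous.
by apply: measurable_funD; apply: measurable_funX.
Qed.

Lemma cmeasurable_modulus f : cmeasurable f ->
  measurable_fun setT (fun x => modulus (f x)).
Proof. by move=> [f1 f2]; exact: measurable_modulus. Qed.

Lemma cintegrable_measurable f : cintegrable f -> cmeasurable f.
Proof.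
by move=> [/integrableP[f1 _] /integrableP[f2 _]]; split; exact/measurable_EFinP.
Qed.

Lemma le_cintegrable f (b : R -> R) : cmeasurable f ->
  mu.-integrable setT (EFin \o b) -> (forall x, modulus (f x) <= b x) ->
  cintegrable f.
Proof.
move=> [f1 f2] ib fb; split; apply: (le_integrable _ _ _ ib) => //=.
- exact/measurable_EFinP.
- move=> x _; rewrite lee_fin (le_trans (normr_Re_le _))//.
  by rewrite (le_trans (fb x))// ler_norm.
- exact/measurable_EFinP.
- move=> x _; rewrite lee_fin (le_trans (normr_Im_le _))//.
  by rewrite (le_trans (fb x))// ler_norm.
Qed.

Lemma integrable_modulus f : cintegrable f ->
  mu.-integrable setT (fun x => (modulus (f x))%:E).
Proof.
move=> fi; have [f1 f2] := fi.
have mf := cintegrable_measurable fi.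
apply: (@le_integrable _ _ _ mu setT measurableT _ (fun x => (`|ReF f x| + `|ImF f x|)%:E)).
- by apply/measurable_EFinP; exact: cmeasurable_modulus.
- move=> x _ /=; rewrite lee_fin ger0_norm ?modulus_ge0//.
  by rewrite ger0_norm ?addr_ge0// modulus_le_ReIm.
- under eq_fun do rewrite EFinD.
  by apply: integrableD => //; exact: integrable_norm.
Qed.

Lemma cintegrableM_bounded f g (K : R) : cmeasurable f ->
  (forall x, modulus (f x) <= K) -> cintegrable g ->
  cintegrable (fun x => f x * g x).
Proof.
move=> mf fK gi; apply: (@le_cintegrable _ (fun x => K * modulus (g x))).
- by apply: cmeasurableM => //; exact: cintegrable_measurable.
- rewrite /comp; under eq_fun do rewrite EFinM.
  by apply: integrableZl => //; exact: integrable_modulus.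
- by move=> x; rewrite modulusM ler_wpM2r ?modulus_ge0.
Qed.

Lemma cintegrableZ (c : C) f : cintegrable f -> cintegrable (fun x => c * f x).
Proof.
by apply: (@cintegrableM_bounded (fun=> c)) => //; exact: cmeasurable_cst.
Qed.

Lemma cintegrable_expiM (u : R -> R) f : measurable_fun setT u ->
  cintegrable f -> cintegrable (fun x => expi (u x) * f x).
Proof.
move=> mu'; apply: (@cintegrableM_bounded _ _ 1).
  exact: cmeasurable_expi.
by move=> x; rewrite modulus_expi.
Qed.

Lemma cintegralD f g : cintegrable f -> cintegrable g ->
  cintegral (fun x => f x + g x) = cintegral f + cintegral g.
Proof.
move=> [f1 f2] [g1 g2]; apply: complex_ext; rewrite ?ReD ?ImD /cintegral /=.
  by rewrite -RintegralD//; apply: eq_Rintegral => x _; rewrite /ReF ReD.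
by rewrite -RintegralD//; apply: eq_Rintegral => x _; rewrite /ImF ImD.
Qed.

Lemma cintegralZ (c : C) f : cintegrable f ->
  cintegral (fun x => c * f x) = c * cintegral f.
Proof.
move=> [f1 f2]; apply: complex_ext; rewrite ?ReM ?ImM /cintegral /=.
  have [i1 i2] : mu.-integrable setT (EFin \o (fun x => Re c * ReF f x)) /\
      mu.-integrable setT (EFin \o (fun x => Im c * ImF f x)).
    by split; rewrite /comp; under eq_fun do rewrite EFinM; exact: integrableZl.
  rewrite -!RintegralZl// -RintegralB//.
  by apply: eq_Rintegral => x _; rewrite /ReF ReM.
have [i1 i2] : mu.-integrable setT (EFin \o (fun x => Re c * ImF f x)) /\
    mu.-integrable setT (EFin \o (fun x => Im c * ReF f x)).
  by split; rewrite /comp; under eq_fun do rewrite EFinM; exact: integrableZl.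
rewrite -!RintegralZl// -RintegralD//.
by apply: eq_Rintegral => x _; rewrite /ImF ImM.
Qed.

Lemma eq_cintegral f g : (forall x, f x = g x) -> cintegral f = cintegral g.
Proof. by move=> fg; congr cintegral; apply/funext. Qed.

(** Rotating the value of the integral onto the nonnegative half-line turns its
    modulus into the integral of a real part, so no constant is lost. *)
Lemma le_modulus_cintegral f : cintegrable f ->
  modulus (cintegral f) <= \int[mu]_x modulus (f x).
Proof.
move=> fi; have [u u1 uE] := modulus_rotate (cintegral f).
have -> : modulus (cintegral f) = Re (cintegral (fun x => u * f x)).
  by rewrite cintegralZ// uE.
rewrite /cintegral /=; apply: le_Rintegral => //.
- by have [] := cintegrableZ u fi.
- exact: integrable_modulus.
- move=> x _; rewrite (le_trans (ler_norm _))// (le_trans (normr_Re_le _))//.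
  by rewrite modulusM u1 mul1r.
Qed.

Lemma ae_mono (P Q : R -> Prop) : (forall x, P x -> Q x) ->
  {ae mu, forall x, P x} -> {ae mu, forall x, Q x}.
Proof. move=> PQ; have F : Filter (almost_everywhere mu) by exact: ae_filter_ringOfSetsType.
by apply: (@filterS _ _ F). Qed.

Lemma ae_eq_cintegral f g : cmeasurable f -> cmeasurable g ->
  {ae mu, forall x, f x = g x} -> cintegral f = cintegral g.
Proof.
move=> [f1 f2] [g1 g2] fg.
have aux (u v : R -> R) : measurable_fun setT u -> measurable_fun setT v ->
    {ae mu, forall x, u x = v x} -> \int[mu]_x u x = \int[mu]_x v x.
  move=> mu' mv uv; rewrite /Rintegral; congr fine.
  apply: ae_eq_integral => //; [exact/measurable_EFinP|exact/measurable_EFinP|].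
  by apply: ae_mono uv => x uvx _; rewrite uvx.
by apply: complex_ext; apply: aux => //; apply: ae_mono fg => x fgx;
  rewrite /ReF /ImF fgx.
Qed.

Lemma cintegral_affine (a b : R) f : a != 0 -> cintegrable f ->
  cintegral (fun x => f (a * x + b)) = (`|a|^-1)%:C * cintegral f.
Proof.
move=> a0 [f1 f2]; apply: complex_ext; rewrite ?ReM ?ImM /cintegral /=
  ?mul0r ?subr0 ?addr0.
  exact: (Rintegral_affine b a0 f1).
exact: (Rintegral_affine b a0 f2).
Qed.

Lemma cintegrable_affine (a b : R) f : a != 0 -> cintegrable f ->
  cintegrable (fun x => f (a * x + b)).
Proof.
move=> a0 [f1 f2].
by split; [exact: (integrable_affine b a0 f1)|exact: (integrable_affine b a0 f2)].
Qed.

Lemma Rintegral_dominated (u_ : nat -> R -> R) (u b : R -> R) :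
  (forall n, measurable_fun setT (u_ n)) -> measurable_fun setT u ->
  {ae mu, forall x, u_ n x @[n --> \oo] --> u x} ->
  mu.-integrable setT (EFin \o b) ->
  (forall n x, `|u_ n x| <= b x) ->
  \int[mu]_x u_ n x @[n --> \oo] --> \int[mu]_x u x.
Proof.
move=> mu_ mu' cu ib ub.
have mu_E n : measurable_fun setT (fun x => (u_ n x)%:E) by exact/measurable_EFinP.
have mu'E : measurable_fun setT (fun x => (u x)%:E) by exact/measurable_EFinP.
have cuE : {ae mu, forall x, setT x -> (u_ n x)%:E @[n --> \oo] --> (u x)%:E}.
  by apply: ae_mono cu => x cux _; apply: cvg_EFin => //; exact: nearW.
have ubE : {ae mu, forall x n, setT x -> (`|(u_ n x)%:E| <= (b x)%:E)%E}.
  by apply: aeW => x n _; rewrite lee_fin.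
have [iu _ cI] :=
  @dominated_convergence _ _ _ mu setT measurableT _ _ _ mu_E mu'E cuE ib ubE.
have := cI; rewrite -(fineK (integrable_fin_num measurableT iu)).
by move/fine_cvgP => [].
Qed.

Lemma cintegral_dominated_ae (f_ : nat -> R -> C) f (b : R -> R) :
  (forall n, cmeasurable (f_ n)) -> cmeasurable f ->
  {ae mu, forall x, ccvg (f_ ^~ x) (f x)} ->
  mu.-integrable setT (EFin \o b) ->
  (forall n x, modulus (f_ n x) <= b x) ->
  ccvg (fun n => cintegral (f_ n)) (cintegral f).
Proof.
move=> mf_ [mf1 mf2] cf ib fb.
split; rewrite /cintegral /=; apply: (@Rintegral_dominated _ _ b) => //.
- by move=> n; case: (mf_ n).
- by apply: ae_mono cf => x [].
- by move=> n x; rewrite (le_trans (normr_Re_le _)).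
- by move=> n; case: (mf_ n).
- by apply: ae_mono cf => x [].
- by move=> n x; rewrite (le_trans (normr_Im_le _)).
Qed.

Lemma cintegral_dominated (f_ : nat -> R -> C) f (b : R -> R) :
  (forall n, cmeasurable (f_ n)) -> (forall x, ccvg (f_ ^~ x) (f x)) ->
  mu.-integrable setT (EFin \o b) ->
  (forall n x, modulus (f_ n x) <= b x) ->
  ccvg (fun n => cintegral (f_ n)) (cintegral f).
Proof.
move=> mf_ cf ib fb; apply: (cintegral_dominated_ae mf_ _ _ ib fb).
  split.
    apply: (measurable_fun_cvg (h := fun n => ReF (f_ n))).
      by move=> n; case: (mf_ n).
    by move=> x _; case: (cf x).
  apply: (measurable_fun_cvg (h := fun n => ImF (f_ n))).
    by move=> n; case: (mf_ n).
  by move=> x _; case: (cf x).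
by apply: aeW => x; exact: cf.
Qed.

(** For some [x] in a null set the inner integral may diverge, in which case its
    real value is a default 0; this does not affect the outer integral. *)
Lemma Rfubini (k : R * R -> R) : (mu \x mu)%E.-integrable setT (EFin \o k) ->
  mu.-integrable setT (fun x => (\int[mu]_y k (x, y))%:E) /\
  \int[mu]_x \int[mu]_y k (x, y) = \int[mu]_y \int[mu]_x k (x, y).
Proof.
move=> ik.
have mF := measurable_fubini_F ik.
have mG := measurable_fubini_G ik.
have M1 : measurable_fun setT (fun x => (\int[mu]_y k (x, y))%:E).
  by apply/measurable_EFinP; apply: measurableT_comp => //; exact: mF.
have M2 : measurable_fun setT (fun y => (\int[mu]_x k (x, y))%:E).
  by apply/measurable_EFinP; apply: measurableT_comp => //; exact: mG.
split.
  apply: (@le_integrable _ _ _ mu setT measurableT _ _ M1 _ (integrable_fubini_F ik)) => x _.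
  rewrite /fubini_F /= /Rintegral.
  by case: (\int[mu]_y (k (x, y))%:E)%E => [r||] //=; rewrite normr0 leey.
rewrite /Rintegral; congr fine.
transitivity (\int[mu]_x \int[mu]_y (k (x, y))%:E)%E.
  apply: ae_eq_integral => //.
  apply: ae_mono (ae_integrable1 ik) => x ikx _.
  by rewrite fineK//; exact: integrable_fin_num ikx.
rewrite (Fubini ik); apply/esym; apply: ae_eq_integral => //.
apply: ae_mono (ae_integrable2 ik) => x ikx _.
by rewrite fineK//; exact: integrable_fin_num ikx.
Qed.

(** A bound on the partial integrals of the modulus makes the kernel integrable on
    the plane; both coordinates are then exchanged separately. *)
Lemma cfubini (K : R * R -> C) (A : R -> R) :
  measurable_fun setT (fun z => Re (K z)) ->
  measurable_fun setT (fun z => Im (K z)) ->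
  mu.-integrable setT (EFin \o A) ->
  (forall x, (\int[mu]_y (modulus (K (x, y)))%:E <= (A x)%:E)%E) ->
  cintegrable (fun x => cintegral (fun y => K (x, y))) /\
  cintegral (fun x => cintegral (fun y => K (x, y))) =
  cintegral (fun y => cintegral (fun x => K (x, y))).
Proof.
move=> mRe mIm iA KA.
have mK := measurable_modulus mRe mIm.
have aux (k : R * R -> R) : measurable_fun setT k ->
    (forall z, `|k z| <= modulus (K z)) -> (mu \x mu)%E.-integrable setT (EFin \o k).
  move=> mk kK; apply/integrable12ltyP; first exact/measurable_EFinP.
  have [_] := integrableP _ _ _ iA; apply: le_lt_trans.
  have mk' x : measurable_fun setT (fun y => `|k (x, y)|%:E).
    by apply/measurable_EFinP; apply: measurableT_comp => //; exact: measurableT_comp.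
  apply: ge0_le_integral => //.
  - by move=> x _; exact: integral_ge0.
  - apply: (measurable_fun_fubini_tonelli_F (m2 := mu) (fun z => `|k z|%:E)) => //.
    by apply/measurable_EFinP; apply: measurableT_comp.
  - apply: measurableT_comp => //; exact: measurable_int iA.
  - move=> x _; apply: le_trans (le_trans (KA x) _); last by rewrite lee_fin ler_norm.
    apply: ge0_le_integral => //.
    + exact: mk'.
    + by apply/measurable_EFinP; apply: (measurableT_comp mK (pair1_measurable x)).
    + by move=> y _; rewrite lee_fin.
have [i1 e1] := Rfubini (aux _ mRe (fun z => normr_Re_le (K z))).
have [i2 e2] := Rfubini (aux _ mIm (fun z => normr_Im_le (K z))).
by split; [split; [exact: i1|exact: i2]|apply: complex_ext; [exact: e1|exact: e2]].
Qed.

End complex_integral.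

(** * Smooth real functions and a bump *)

Section smooth_functions.
Variable R : realType.
Implicit Types u v : R -> R.

Lemma is_derive_fun u v : (forall x : R, is_derive x 1 u (v x)) -> derive1 u = v.
Proof. by move=> duv; apply/funext => x; rewrite derive1E; apply: derive_val. Qed.

(** A class of functions stable under differentiation consists of smooth
    functions. The primitive smoothness results
    exhibit such a class. *)
Lemma smooth_coind (P : (R -> R) -> Prop) :
  (forall u, P u -> exists2 v, P v & forall x : R, is_derive x 1 u (v x)) ->
  forall u, P u -> smooth u.
Proof.
move=> PP u Pu n; have : P (derive1n n u).
  elim: n => [//|n /PP[v Pv dv]].
  by rewrite /derive1n iterS -/(derive1n n u) (is_derive_fun dv).
by move=> /PP[v _ dv] x; apply: ex_derive.
Qed.

Lemma smooth_is_derive u (x : R) : smooth u -> is_derive x 1 u (derive1 u x).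
Proof.
by move=> su; rewrite derive1E; apply/derivableP; exact: (su 0%N).
Qed.

Lemma smooth_derive u : smooth u -> smooth (derive1 u).
Proof.
move=> su n x; have := su n.+1 x.
by rewrite /derive1n iterSr.
Qed.

#[local] Opaque smooth.

Lemma smooth_continuous u : smooth u -> continuous u.
Proof.
move=> su x; apply/differentiable_continuous/derivable1_diffP.
 apply: ex_derive; exact: smooth_is_derive.
Qed.

Lemma smooth_measurable u : smooth u -> measurable_fun setT u.
Proof.
by move=> su; apply: continuous_measurable_fun; exact: smooth_continuous.
Qed.

Lemma is_derive_mul u v (x du dv : R) : is_derive x 1 u du -> is_derive x 1 v dv ->
  is_derive x 1 (fun t => u t * v t) (u x * dv + v x * du).
Proof. by move=> hu hv; exact: is_deriveM. Qed.

Lemma is_derive_add u v (x du dv : R) : is_derive x 1 u du -> is_derive x 1 v dv ->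
  is_derive x 1 (fun t => u t + v t) (du + dv).
Proof. by move=> hu hv; exact: is_deriveD. Qed.

Lemma is_derive_scale u (c x du : R) : is_derive x 1 u du ->
  is_derive x 1 (fun t => c * u t) (c * du).
Proof. by move=> hu; exact: is_deriveZ. Qed.

Lemma is_derive_pow u (n : nat) (x du : R) : is_derive x 1 u du ->
  is_derive x 1 (fun t => u t ^+ n) (n%:R * u x ^+ n.-1 * du).
Proof.
move=> hu; elim: n => [|n IH].
  by rewrite !mul0r; under eq_fun do rewrite expr0; exact: is_derive_cst.
have h := is_derive_mul hu IH.
apply: is_derive_eq; first by under eq_fun do rewrite exprS; exact: h.
case: n {IH h} => [|n]; rewrite /= ?expr0 ?exprS -?natr1; ring.
Qed.

Lemma is_derive_lin (a b x : R) : is_derive x 1 (fun t => a * t + b) a.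
Proof.
rewrite -[X in is_derive _ _ _ X]addr0; apply: is_derive_add.
by rewrite -[X in is_derive _ _ _ X]mulr1; apply: is_derive_scale.
Qed.

Lemma is_derive_comp_affine u (a b x du : R) : is_derive (a * x + b) 1 u du ->
  is_derive x 1 (fun t => u (a * t + b)) (a * du).
Proof.
move=> hu; have hl := is_derive_lin a b x.
by rewrite mulrC; exact: (@is_derive1_comp _ u (fun t => a * t + b)).
Qed.

Lemma smooth_affine u (a b : R) : smooth u -> smooth (fun x => u (a * x + b)).
Proof.
move=> su; apply: (@smooth_coind
    (fun w => exists c v, smooth v /\ w = (fun x => c * v (a * x + b)))); last first.
  by exists 1, u; split=> //; apply/funext => x; rewrite mul1r.
move=> _ [c [v [sv ->]]]; exists (fun x => c * a * derive1 v (a * x + b)).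
  by exists (c * a), (derive1 v); split; [exact: smooth_derive|].
by move=> x; rewrite -mulrA; apply: is_derive_scale; apply: is_derive_comp_affine;
  exact: smooth_is_derive.
Qed.

Lemma smoothD u v : smooth u -> smooth v -> smooth (fun x => u x + v x).
Proof.
move=> su sv; apply: (@smooth_coind
   (fun w => exists a b, [/\ smooth a, smooth b & w = (fun x => a x + b x)])); last first.
  by exists u, v.
move=> _ [a [b [sa sb ->]]]; exists (fun x => derive1 a x + derive1 b x).
  by exists (derive1 a), (derive1 b); split; [exact: smooth_derive|exact: smooth_derive|].
by move=> x; apply: is_derive_add; exact: smooth_is_derive.
Qed.

(** By the product rule these sums are stable under differentiation, which a
    single product is not. *)
Inductive sum_of_products : (R -> R) -> Prop :=
| Product u v : smooth u -> smooth v -> sum_of_products (fun x => u x * v x)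
| Sum u v : sum_of_products u -> sum_of_products v ->
    sum_of_products (fun x => u x + v x).

Lemma smoothM u v : smooth u -> smooth v -> smooth (fun x => u x * v x).
Proof.
move=> su sv; apply: (@smooth_coind sum_of_products); last exact: Product.
move=> w; elim=> {w u v su sv} [u v su sv|u v _ [u' Pu du] _ [v' Pv dv]].
  exists (fun x => u x * derive1 v x + v x * derive1 u x).
    exact: (Sum (Product su (smooth_derive sv)) (Product sv (smooth_derive su))).
  by move=> x; apply: is_derive_mul; exact: smooth_is_derive.
exists (fun x => u' x + v' x); first exact: Sum.
by move=> x; exact: is_derive_add.
Qed.

Lemma smooth_cst (c : R) : smooth (fun=> c).
Proof.
apply: (@smooth_coind (fun w => exists k, w = fun=> k)); last by exists c.
by move=> _ [k ->]; exists (fun=> 0); [exists 0|move=> x; exact: is_derive_cst].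
Qed.

Lemma smooth_pow (n : nat) : smooth (fun x : R => x ^+ n).
Proof.
elim: n => [|n IH]; first by under eq_fun do rewrite expr0; exact: smooth_cst.
under eq_fun do rewrite exprS; apply: (@smoothM id (fun x => x ^+ n)); last exact: IH.
apply: (@smooth_coind (fun w => w = id \/ exists k, w = fun=> k)); last by left.
move=> _ [->|[k ->]].
  by exists (fun=> 1); [right; exists 1|move=> x; exact: is_derive_id].
by exists (fun=> 0); [right; exists 0|move=> x; exact: is_derive_cst].
Qed.

Lemma smoothZ (c : R) u : smooth u -> smooth (fun x => c * u x).
Proof. by apply: smoothM; exact: smooth_cst. Qed.

Lemma smooth_cos_sin (a b : R) : smooth (fun x => a * cos x + b * sin x).
Proof.
apply: (@smooth_coind (fun w => exists a b, w = fun x => a * cos x + b * sin x));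
  last by exists a, b.
move=> _ [c [d ->]]; exists (fun x => d * cos x + (- c) * sin x); first by exists d, (- c).
move=> x; rewrite addrC mulNr -mulrN.
have h1 := is_derive_scale c (is_derive_cos x).
have h2 := is_derive_scale d (is_derive_sin x).
exact: is_derive_add h1 h2.
Qed.

Lemma smooth_cos : smooth (@cos R).
Proof.
have := @smooth_cos_sin 1 0; congr smooth; apply/funext => x.
by rewrite mul1r mul0r addr0.
Qed.

Lemma smooth_sin : smooth (@sin R).
Proof.
have := @smooth_cos_sin 0 1; congr smooth; apply/funext => x.
by rewrite mul1r mul0r add0r.
Qed.

(** The functions [x ^ (- n) * exp (- 1 / x)], cut off on the negative half-line,
    span a space stable under differentiation, whence a smooth function which is
    flat at the origin. *)
Definition flat (n : nat) (x : R) : R :=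
  if 0 < x then x^-1 ^+ n * expR (- x^-1) else 0.

(** Since [exp t >= t ^ (n + 1) / (n + 1)!] for [t = 1 / x], every member of the
    family vanishes at least linearly at 0. As dividing by [x] leads to the next
    member, this also gives differentiability at 0. *)
Lemma flat_le (n : nat) (x : R) : 0 <= flat n x <= (n.+1)`!%:R * `|x|.
Proof.
rewrite /flat; case: ifPn => x0; last by rewrite lexx mulr_ge0.
have xi : 0 <= x^-1 by rewrite invr_ge0 ltW.
rewrite mulr_ge0 ?exprn_ge0 ?expR_ge0//= gtr0_norm//.
have := expR_ge1Dxn n xi; set f := (_`!)%:R => h.
have f0 : 0 < f by rewrite ltr0n fact_gt0.
rewrite expRN ler_pdivrMr ?expR_gt0//.
have : x^-1 ^+ n.+1 / f <= expR x^-1 by lra.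
rewrite ler_pdivrMr// => h2.
have -> : x^-1 ^+ n = x * x^-1 ^+ n.+1 by rewrite exprS mulrA divff ?mul1r// gt_eqF.
have -> : f * x * expR x^-1 = x * (expR x^-1 * f) by ring.
by rewrite ler_pM2l.
Qed.

Lemma is_derive_flat (n : nat) (x : R) :
  is_derive x 1 (flat n) (flat n.+2 x - n%:R * flat n.+1 x).
Proof.
have [x0|x0|->] := ltgtP x 0.
- rewrite /flat !ltNge (ltW x0) /= mulr0 subr0.
  apply: (@near_eq_is_derive _ _ _ (fun=> 0)).
  near=> y; rewrite ltNge (_ : y <= 0)//; apply/ltW; near: y.
  exact: lt_nbhsl.
- have dn : is_derive x 1 (fun t : R => t^-1 ^+ n * expR (- t^-1))
      (x^-1 ^+ n.+2 * expR (- x^-1) - n%:R * (x^-1 ^+ n.+1 * expR (- x^-1))).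
    have di : is_derive x 1 (fun t : R => t^-1) (- x ^- 2 *: 1).
      by apply: is_deriveV; rewrite gt_eqF.
    have dni : is_derive x 1 (fun t : R => - t^-1) (- (- x ^- 2 *: 1)).
      exact: is_deriveN.
    have de := @is_derive1_comp _ expR _ x _ _ (is_derive_expR (- x^-1)) dni.
    apply: (is_derive_eq (is_derive_mul (is_derive_pow n di) de)).
    rewrite /= /GRing.scale /=; case: n => [|n]; rewrite /= !exprS ?expr0.
      by field; rewrite gt_eqF.
    by field; rewrite gt_eqF.
  rewrite /flat x0; apply: near_eq_is_derive dn.
  near=> y; rewrite (_ : 0 < y)//; near: y; exact: lt_nbhsr.
- have -> : flat n.+2 0 - n%:R * flat n.+1 0 = 0.
    by rewrite /flat ltxx mulr0 subr0.
  have H : h^-1 *: ((flat n \o shift 0) (h *: 1) - flat n 0) @[h --> 0^'] --> (0 : R).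
    apply: norm_cvg0.
    apply: (@squeeze_cvgr _ _ _ _ (cst 0) (fun h => (n.+2)`!%:R * `|h|)).
    + near=> h; rewrite normr_ge0/=.
      have h0 : h != 0 by near: h; exact: nbhs_dnbhs_neq.
      have -> : h^-1 *: (flat n (h%:A + 0) - flat n 0) = flat n.+1 h.
        rewrite addr0 /GRing.scale /= mulr1 /flat ltxx subr0.
        by case: ifP => _; rewrite ?mulr0// mulrA exprS.
      by have /andP[f1 f2] := flat_le n.+1 h; rewrite ger0_norm.
    + exact: cvg_cst.
    + rewrite -[X in _ --> X](mulr0 (n.+2)`!%:R); apply: cvgM; first exact: cvg_cst.
      rewrite -[X in _ --> X](@normr0 _ R); apply: cvg_norm.
      exact: nbhs_dnbhs.
  exact: DeriveDef (cvgP _ H) (cvg_lim _ H).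
Unshelve. all: by end_near. Qed.

Inductive flat_span : (R -> R) -> Prop :=
| Flat n : flat_span (flat n)
| FlatLin c u v : flat_span u -> flat_span v -> flat_span (fun x => c * u x + v x).

Lemma smooth_flat n : smooth (flat n).
Proof.
apply: (@smooth_coind flat_span); last exact: Flat.
move=> u; elim=> {u n} [n|c u v _ [u' Pu du] _ [v' Pv dv]].
  exists (fun x => (- n%:R) * flat n.+1 x + flat n.+2 x).
    exact: (FlatLin _ (Flat _) (Flat _)).
  by move=> x; rewrite addrC mulNr; exact: is_derive_flat.
exists (fun x => c * u' x + v' x); first exact: FlatLin.
by move=> x; exact: (is_derive_add (is_derive_scale c (du x)) (dv x)).
Qed.

(** The product is flat at both ends of [-1, 1] and equals
    [exp (2 - 2 / (1 - x ^ 2))] inside: it lies between 0 and 1, and is 1 at 0. *)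
Definition bump (x : R) : R := expR 2 * (flat 0 (1 * x + 1) * flat 0 ((- 1) * x + 1)).

Lemma smooth_bump : smooth bump.
Proof.
apply: smoothZ; apply: (@smoothM (fun x => flat 0 (1 * x + 1))).
  by apply: (@smooth_affine (flat 0)); exact: smooth_flat.
by apply: (@smooth_affine (flat 0)); exact: smooth_flat.
Qed.

Lemma bump0 : bump 0 = 1.
Proof.
rewrite /bump /flat !mulr0 !add0r ltr01 expr0 !mul1r invr1 -!expRD.
by rewrite (_ : _ + _ = 0) ?expR0//; ring.
Qed.

Lemma bump_out x : 1 < `|x| -> bump x = 0.
Proof.
rewrite /bump /flat; case: ifPn => [x1|]; last by rewrite mul0r mulr0.
case: ifPn => [x2|]; last by rewrite !mulr0.
by rewrite ltNge ler_norml => /negP[]; apply/andP; split; lra.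
Qed.

Lemma bump_ge0_le1 x : 0 <= bump x <= 1.
Proof.
rewrite /bump /flat; case: ifPn => [x1|]; last by rewrite mul0r mulr0 lexx ler01.
case: ifPn => [x2|]; last by rewrite !mulr0 lexx ler01.
rewrite !expr0 !mul1r -!expRD expR_ge0/= expR_le1.
have h : 2 <= (x + 1)^-1 + (-1 * x + 1)^-1.
  have -> : (x + 1)^-1 + (-1 * x + 1)^-1 = 2 / ((x + 1) * (-1 * x + 1)).
    by field; rewrite !gt_eqF//; lra.
  have p0 : 0 < (x + 1) * (-1 * x + 1) by apply: mulr_gt0; lra.
  by rewrite ler_pdivlMr//; nra.
lra.
Qed.

End smooth_functions.

(** * Test functions *)

Section test_functions.
Variable R : realType.
Local Notation C := R[i].
Local Notation Re := complex.Re.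
Local Notation Im := complex.Im.
Local Notation mu := (@lebesgue_measure R).
Implicit Types f g : R -> C.

Definition csmooth f := smooth (ReF f) /\ smooth (ImF f).

Lemma csmoothM f g : csmooth f -> csmooth g -> csmooth (fun x => f x * g x).
Proof.
move=> [f1 f2] [g1 g2]; split.
  have -> : ReF (fun x => f x * g x) =
      (fun x => ReF f x * ReF g x + (-1) * (ImF f x * ImF g x)).
    by apply/funext => x; rewrite /ReF ReM mulN1r.
  by apply: smoothD; [exact: smoothM|apply: smoothZ; exact: smoothM].
have -> : ImF (fun x => f x * g x) = (fun x => ReF f x * ImF g x + ImF f x * ReF g x).
  by apply/funext => x; rewrite /ImF ImM.
by apply: smoothD; exact: smoothM.
Qed.

Lemma csmooth_cst (c : C) : csmooth (fun=> c).
Proof. by split; exact: smooth_cst. Qed.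

Lemma csmooth_real (u : R -> R) : smooth u -> csmooth (fun x => (u x)%:C).
Proof. by move=> su; split; [exact: su|exact: smooth_cst]. Qed.

Lemma csmooth_affine f (a b : R) : csmooth f -> csmooth (fun x => f (a * x + b)).
Proof.
by move=> [f1 f2]; split; [exact: (@smooth_affine _ (ReF f))|exact: (@smooth_affine _ (ImF f))].
Qed.

Lemma csmooth_expi (a : R) : csmooth (fun x => expi (a * x)).
Proof.
split.
  have := @smooth_affine _ _ a 0 (@smooth_cos R); congr smooth.
  by apply/funext => x; rewrite addr0.
have := @smooth_affine _ _ a 0 (@smooth_sin R); congr smooth.
by apply/funext => x; rewrite addr0.
Qed.

(** The closed support is compact exactly when the function vanishes outside a
    bounded interval. *)
Lemma test_funP f :
  test_fun f <-> csmooth f /\ exists M, forall x, M < `|x| -> f x = 0.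
Proof.
split=> [[f1 f2 cf]|[[f1 f2] [M fM]]].
  split; first by split.
  have [M [_ HM]] := compact_bounded cf; exists (M + 1) => x xM.
  apply/eqP; apply/negPn/negP => fx.
  have : `|x| <= M + 1 by apply: HM; [rewrite ltrDl|exact: subset_closure].
  by rewrite leNgt xM.
split=> //; apply: (@subclosed_compact _ _ `[- M, M]).
- exact: closed_closure.
- exact: segment_compact.
- have -> : `[- M, M]%classic = closure `[- M, M]%classic.
    by apply/closure_id; exact: itv_closed.
  apply: closureS => x /= fx; rewrite in_itv /= -ler_norml leNgt.
  by apply/negP => /fM fx0; rewrite fx0 eqxx in fx.
Qed.

Lemma test_funM f g : csmooth f -> test_fun g -> test_fun (fun x => f x * g x).
Proof.
move=> sf /test_funP[sg [M gM]]; apply/test_funP; split; first exact: csmoothM.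
by exists M => x /gM ->; rewrite mulr0.
Qed.

Lemma test_funZ (c : C) g : test_fun g -> test_fun (fun x => c * g x).
Proof. by apply: test_funM; exact: csmooth_cst. Qed.

Lemma test_fun_affine f (a b : R) : a != 0 -> test_fun f ->
  test_fun (fun x => f (a * x + b)).
Proof.
move=> a0 /test_funP[sf [M fM]]; apply/test_funP; split; first exact: csmooth_affine.
exists ((M + `|b|) / `|a|) => x; rewrite ltr_pdivrMr ?normr_gt0// => xM.
apply: fM; rewrite -(ltrD2r `|b|); apply: lt_le_trans xM _.
rewrite mulrC -normrM -[a * x](addrK b); apply: le_trans (ler_normB _ _) _.
by rewrite addrK.
Qed.

Lemma test_fun_Re f : test_fun f -> test_fun (fun x => (ReF f x)%:C).
Proof.
move=> /test_funP[[s1 s2] [M fM]]; apply/test_funP; split; first exact: csmooth_real.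
by exists M => x /fM h; rewrite /ReF h.
Qed.

Lemma test_fun_Im f : test_fun f -> test_fun (fun x => (ImF f x)%:C).
Proof.
move=> /test_funP[[s1 s2] [M fM]]; apply/test_funP; split; first exact: csmooth_real.
by exists M => x /fM h; rewrite /ImF h.
Qed.

Definition cderive f (x : R) : C := derive1 (ReF f) x +i* derive1 (ImF f) x.

Lemma derive1_out (u : R -> R) (M : R) : (forall x, M < `|x| -> u x = 0) ->
  forall x, M < `|x| -> derive1 u x = 0.
Proof.
move=> uM x xM; rewrite derive1E.
rewrite (@near_eq_derive _ _ _ u (fun=> 0)) ?derive_cst//.
near=> y; apply: uM; near: y.
have : (fun y : R => `|y|) y @[y --> x] --> `|x| by apply: cvg_norm; exact: cvg_id.
by move/cvgr_gt => /(_ _ xM).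
Unshelve. all: by end_near. Qed.

Lemma test_fun_cderive f : test_fun f -> test_fun (cderive f).
Proof.
move=> /test_funP[[s1 s2] [M fM]]; apply/test_funP; split.
  by split; apply: smooth_derive.
exists M => x xM; apply: complex_ext; rewrite /=.
  by apply: derive1_out xM => y /fM fy; rewrite /ReF fy.
by apply: derive1_out xM => y /fM fy; rewrite /ImF fy.
Qed.

Lemma compact_support_bounded (u : R -> R) (M : R) : continuous u ->
  (forall x, M < `|x| -> u x = 0) -> exists K, forall x, `|u x| <= K.
Proof.
move=> cu uM.
have : compact (u @` `[- M, M]%classic).
  by apply: continuous_compact; [exact: continuous_subspaceT|exact: segment_compact].
move=> /compact_bounded[K [_ HK]]; exists (`|K| + 1) => x.
have [xM|xM] := leP `|x| M; last by rewrite (uM _ xM) normr0 addr_ge0.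
apply: HK; first by rewrite (le_lt_trans (ler_norm _))// ltrDl.
by exists x => //=; rewrite in_itv /= -ler_norml.
Qed.

Lemma test_fun_bounded f : test_fun f -> exists K, forall x, modulus (f x) <= K.
Proof.
move=> /test_funP[[s1 s2] [M fM]].
have [K1 h1] : exists K, forall x, `|ReF f x| <= K.
  apply: (@compact_support_bounded _ M); first exact: smooth_continuous.
  by move=> x /fM fx; rewrite /ReF fx.
have [K2 h2] : exists K, forall x, `|ImF f x| <= K.
  apply: (@compact_support_bounded _ M); first exact: smooth_continuous.
  by move=> x /fM fx; rewrite /ImF fx.
exists (K1 + K2) => x; apply: le_trans (modulus_le_ReIm _) _.
by rewrite lerD//; [exact: h1|exact: h2].
Qed.

Lemma csmooth_measurable f : csmooth f -> cmeasurable f.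
Proof. by move=> [s1 s2]; split; exact: smooth_measurable. Qed.

Lemma test_fun_measurable f : test_fun f -> cmeasurable f.
Proof. by move=> /test_funP[sf _]; exact: csmooth_measurable. Qed.

(** The majorant lies in every Lebesgue space. *)
Lemma test_fun_dominated f : test_fun f -> exists K M : R,
  [/\ 0 <= K, 0 <= M & forall x, modulus (f x) <= K * \1_(`[- M, M]%classic) x].
Proof.
move=> tf; have [K fK] := test_fun_bounded tf.
have /test_funP[_ [M fM]] := tf.
exists `|K|, `|M|; split => // x; rewrite indicE.
have [_|] := boolP (x \in _).
  by rewrite mulr1 (le_trans (fK x))// ler_norm.
move/negP=> nx; rewrite fM ?modulus0 ?mulr0//.
rewrite ltNge; apply/negP => xM; apply: nx; apply/mem_set => /=.
by rewrite in_itv /= -ler_norml (le_trans xM)// ler_norm.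
Qed.

Lemma integrable_indic_segment (K M : R) :
  mu.-integrable setT (fun x => (K * \1_(`[- M, M]%classic) x)%:E).
Proof.
under eq_fun do rewrite EFinM.
apply: integrableZl => //; apply: integrable_indic_itv.
Qed.

Lemma test_fun_integrable f : test_fun f -> cintegrable f.
Proof.
move=> tf; have [K [M [K0 M0 fK]]] := test_fun_dominated tf.
apply: (le_cintegrable (test_fun_measurable tf) _ fK).
exact: integrable_indic_segment.
Qed.

End test_functions.

(** * Fourier transforms of test functions *)

Section fourier_of_test_functions.
Variable R : realType.
Local Notation C := R[i].
Local Notation Re := complex.Re.
Local Notation Im := complex.Im.
Local Notation mu := (@lebesgue_measure R).
Implicit Types f g G : R -> C.

#[local] Opaque smooth test_fun.

Lemma integral_oneDsqrV : (\int[mu]_x ((1 + x ^+ 2)^-1)%:E = pi%:E)%E.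
Proof.
have := @ge0_symfun_integralT R (fun x => (oneDsqr x)^-1) _ (@continuous_oneDsqrV R).
move=> /=; rewrite /oneDsqr => ->.
- rewrite -set_itvcy integral0y_oneDsqr -EFinM; congr EFin.
  by rewrite mulrC divfK.
- by move=> x; rewrite invr_ge0 addr_ge0 ?sqr_ge0.
- by move=> x /=; rewrite sqrrN.
Qed.

Lemma measurable_oneDsqrV : measurable_fun setT (fun x : R => (1 + x ^+ 2)^-1).
Proof. by apply: continuous_measurable_fun; exact: continuous_oneDsqrV. Qed.

Lemma integrable_oneDsqrV : mu.-integrable setT (fun x => ((1 + x ^+ 2)^-1)%:E).
Proof.
apply/integrableP; split; first by apply/measurable_EFinP; exact: measurable_oneDsqrV.
under eq_integral => x _.
  rewrite gee0_abs; last by rewrite lee_fin invr_ge0 addr_ge0 ?sqr_ge0.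
  over.
by rewrite integral_oneDsqrV ltry.
Qed.

Lemma integral_derive1_0 (u : R -> R) (M : R) : smooth u ->
  (forall x, M < `|x| -> u x = 0) -> \int[mu]_x derive1 u x = 0.
Proof.
move=> su uM; pose N := `|M| + 1.
have N0 : 0 < N by rewrite ltr_wpDl.
have MN : M < N by rewrite (le_lt_trans (ler_norm _))// ltrDl.
have cu := smooth_continuous su.
have du' := derive1_out uM.
rewrite /Rintegral.
have -> : (\int[mu]_x (derive1 u x)%:E = \int[mu]_(x in `[(- N)%R, N]) (derive1 u x)%:E)%E.
  rewrite [RHS]integral_mkcond; apply: eq_integral => x _.
  rewrite patchE; case: ifPn => // /negP nx.
  rewrite du'//; apply: lt_trans MN _; rewrite ltNge; apply/negP => xN.
  by apply: nx; apply/mem_set; rewrite /= in_itv /= -ler_norml.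
rewrite (@continuous_FTC2 _ (derive1 u) u).
- rewrite !uM ?normrN ?(gtr0_norm N0)//=; lra.
- lra.
- by apply: continuous_subspaceT; exact: smooth_continuous (smooth_derive su).
- split.
  + by move=> x _; apply: ex_derive; exact: smooth_is_derive.
  + by apply: cvg_at_right_filter; exact: cu.
  + by apply: cvg_at_left_filter; exact: cu.
- by [].
Qed.

Lemma cintegral_cderive f : test_fun f -> cintegral (cderive f) = 0.
Proof.
move=> /test_funP[[s1 s2] [M fM]]; apply: complex_ext; rewrite /cintegral /=.
  by apply: (@integral_derive1_0 _ M) => // x /fM; rewrite /ReF => ->.
by apply: (@integral_derive1_0 _ M) => // x /fM; rewrite /ImF => ->.
Qed.

Lemma cderiveE f g : (forall x : R, is_derive x 1 (ReF f) (ReF g x)) ->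
  (forall x : R, is_derive x 1 (ImF f) (ImF g x)) -> cderive f = g.
Proof.
move=> h1 h2; apply/funext => x; apply: complex_ext => /=.
  by rewrite (is_derive_fun h1).
by rewrite (is_derive_fun h2).
Qed.

Lemma cderiveM f g : csmooth f -> csmooth g ->
  cderive (fun x => f x * g x) = (fun x => f x * cderive g x + cderive f x * g x).
Proof.
move=> [f1 f2] [g1 g2]; apply: cderiveE => x.
  have h1 := is_derive_mul (smooth_is_derive x f1) (smooth_is_derive x g1).
  have h2 := is_derive_mul (smooth_is_derive x f2) (smooth_is_derive x g2).
  have h3 := is_derive_add h1 (is_derive_scale (-1) h2).
  rewrite (_ : ReF _ = fun x => ReF f x * ReF g x + (-1) * (ImF f x * ImF g x)).
    by apply: (is_derive_eq h3); rewrite /ReF !(ReD, ReM) /=; lra.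
  by apply/funext => y; rewrite /ReF ReM mulN1r.
have h1 := is_derive_mul (smooth_is_derive x f1) (smooth_is_derive x g2).
have h2 := is_derive_mul (smooth_is_derive x f2) (smooth_is_derive x g1).
have h3 := is_derive_add h1 h2.
rewrite (_ : ImF _ = fun x => ReF f x * ImF g x + ImF f x * ReF g x).
  by apply: (is_derive_eq h3); rewrite /ImF !(ImD, ImM) /=; lra.
by apply/funext => y; rewrite /ImF ImM.
Qed.

Lemma cderive_expi (a : R) :
  cderive (fun x => expi (a * x)) = (fun x => ('i * a%:C) * expi (a * x)).
Proof.
apply: cderiveE => x.
  have hc : is_derive (a * x + 0) 1 cos (- sin (a * x + 0)) by exact: is_derive_cos.
  have := is_derive_comp_affine hc; under eq_fun do rewrite addr0.
  by move=> h; apply: (is_derive_eq h); rewrite /ReF !(ReM, ImM) /= addr0; lra.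
have hc : is_derive (a * x + 0) 1 sin (cos (a * x + 0)) by exact: is_derive_sin.
have := is_derive_comp_affine hc; under eq_fun do rewrite addr0.
by move=> h; apply: (is_derive_eq h); rewrite /ImF !(ReM, ImM) /= addr0; lra.
Qed.

Lemma fourier_phaseE (x y : R) : - (2 * pi * x * y) = - (2 * pi * y) * x.
Proof. ring. Qed.

(** Integration by parts, in the form: the derivative of the test function
    [expi (- 2 pi x y) * f x] has integral 0. *)
Lemma fourier_cderive f y : test_fun f ->
  fourier (cderive f) y = ('i * (2 * pi * y)%:C) * fourier f y.
Proof.
move=> tf; pose a := - (2 * pi * y).
have sf : csmooth f by have /test_funP[] := tf.
have tg : test_fun (fun x => expi (a * x) * f x).
  by apply: test_funM tf; exact: csmooth_expi.
have := cintegral_cderive tg.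
rewrite (cderiveM (csmooth_expi a) sf).
rewrite cderive_expi cintegralD; last 2 first.
- apply: test_fun_integrable; apply: test_funM; first exact: csmooth_expi.
  exact: test_fun_cderive.
- under eq_fun do rewrite -(mulrA _ (expi _)).
  by apply: cintegrableZ; exact: test_fun_integrable.
under [X in _ + X]eq_cintegral do rewrite -(mulrA _ (expi _)).
rewrite cintegralZ; last exact: test_fun_integrable.
move=> /eqP; rewrite addr_eq0 => /eqP h.
rewrite /fourier; under eq_cintegral do rewrite fourier_phaseE.
rewrite -/a h -mulNr; congr (_ * _).
  by apply: complex_ext; rewrite ?ReN ?ImN !(ReM, ImM) /= /a; lra.
by apply: eq_cintegral => x; rewrite fourier_phaseE.
Qed.

Lemma fourier_le f y : test_fun f -> modulus (fourier f y) <= \int[mu]_x modulus (f x).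
Proof.
move=> tf; have h : cintegrable (fun x => expi (- (2 * pi * x * y)) * f x).
  apply: cintegrable_expiM; last exact: test_fun_integrable.
  under eq_fun do rewrite fourier_phaseE.
  by apply: measurable_funM.
apply: le_trans (le_modulus_cintegral h) _.
by under eq_Rintegral do rewrite modulusM modulus_expi mul1r.
Qed.

(** Integrating by parts [k] times trades [k] factors [y] for derivatives of [f],
    whose transforms are bounded. *)
Lemma fourier_decay f k : test_fun f ->
  exists K, forall y, `|y| ^+ k * modulus (fourier f y) <= K.
Proof.
have p0 : 0 < 2 * pi :> R by rewrite mulr_gt0// pi_gt0.
elim: k f => [|k IH] f tf.
  by exists (\int[mu]_x modulus (f x)) => y; rewrite expr0 mul1r fourier_le.
have [K HK] := IH _ (test_fun_cderive tf); exists (K / (2 * pi)) => y.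
have := HK y; rewrite fourier_cderive// !modulusM modulus_i modulus_real mul1r.
rewrite normrM (gtr0_norm p0) ler_pdivlMr// exprS; apply: le_trans.
by rewrite le_eqVlt; apply/orP; left; apply/eqP; ring.
Qed.

Lemma realCM (x y : R) : (x * y)%:C = x%:C * y%:C.
Proof. by apply: complex_ext; rewrite ?ReM ?ImM /=; ring. Qed.

(** The class of functions whose inverse Fourier integral may be differentiated
    under the integral sign indefinitely. *)
Definition has_moments G :=
  cmeasurable G /\ forall k, cintegrable (fun y => (y ^+ k)%:C * G y).

Definition inverse_fourier G (x : R) : C :=
  cintegral (fun y => expi (2 * pi * x * y) * G y).

Lemma has_momentsM G : has_moments G -> forall c : C,
  has_moments (fun y => c * y%:C * G y).
Proof.
move=> [mG iG] c; split.
  apply: cmeasurableM => //; apply: cmeasurableM; first exact: cmeasurable_cst.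
  exact: cmeasurable_real.
move=> k; have := cintegrableZ c (iG k.+1); congr cintegrable.
by apply/funext => y; rewrite exprS realCM; ring.
Qed.

Lemma measurable_scale (a : R) : measurable_fun setT (fun y : R => a * y).
Proof. by apply: measurable_funM. Qed.

Lemma has_moments_integrable G : has_moments G -> cintegrable G.
Proof.
move=> [_ iG]; have := iG 0%N; congr cintegrable.
by apply/funext => y; rewrite expr0 mul1r.
Qed.

(** Differentiation under the integral sign: the [x]-derivative of the integrand
    is dominated by the first moment of [G], uniformly in [x]. *)
Lemma is_derive_Re_inverse_fourier G (x : R) : has_moments G ->
  is_derive x 1 (ReF (inverse_fourier G))
    (ReF (inverse_fourier (fun y => ('i * (2 * pi)%:C) * y%:C * G y)) x).
Proof.
move=> mG; have iG := has_moments_integrable mG.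
pose k (t y : R) := Re (expi (2 * pi * t * y) * G y).
have dk (t y : R) : is_derive t 1 (k ^~ y)
    (Re (expi (2 * pi * t * y) * (('i * (2 * pi)%:C) * y%:C * G y))).
  have hc : is_derive (2 * pi * y * t + 0) 1 cos (- sin (2 * pi * y * t + 0)).
    exact: is_derive_cos.
  have hs : is_derive (2 * pi * y * t + 0) 1 sin (cos (2 * pi * y * t + 0)).
    exact: is_derive_sin.
  have h := is_derive_add (is_derive_scale (Re (G y)) (is_derive_comp_affine hc))
    (is_derive_scale (- Im (G y)) (is_derive_comp_affine hs)).
  rewrite (_ : k ^~ y = fun u => Re (G y) * cos (2 * pi * y * u + 0) +
      - Im (G y) * sin (2 * pi * y * u + 0)).
    apply: (is_derive_eq h); rewrite addr0 (mulrAC _ t y) !(ReM, ImM) /=; ring.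
  by apply/funext => u; rewrite /k addr0 (mulrAC _ u y) !ReM /=; ring.
have ik t : mu.-integrable setT (EFin \o k t).
  have := @cintegrable_expiM _ (fun y => 2 * pi * t * y) _ (measurable_scale _) iG.
  by case.
pose B y := 2 * pi * modulus (y%:C * G y).
have p0 : 0 <= 2 * pi :> R by rewrite mulr_ge0// pi_ge0.
have iB : mu.-integrable setT (EFin \o B).
  rewrite /B /comp; under eq_fun do rewrite EFinM.
  apply: integrableZl => //; apply: integrable_modulus.
  have [_ /(_ 1%N)] := mG; congr cintegrable.
have B0 y : 0 <= B y by rewrite mulr_ge0// modulus_ge0.
have d1k t y : partial1of2 k t y =
    Re (expi (2 * pi * t * y) * (('i * (2 * pi)%:C) * y%:C * G y)).
  by rewrite partial1of2E; apply: derive_val.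
have Bk t y : `|partial1of2 k t y| <= B y.
  rewrite d1k; apply: le_trans (normr_Re_le _) _.
  by rewrite /B !modulusM modulus_expi modulus_i !modulus_real (ger0_norm p0) !mul1r mulrA.
have Ix : (`](x - 1), (x + 1)[%classic : set R) x by rewrite /= in_itv /=; lra.
have dkI t y : derivable (k ^~ y) t 1 by apply: ex_derive; exact: dk.
have h1 := @derivable_under_integral _ _ _ mu k setT measurableT x _ _ Ix
  (fun t _ => ik t) (fun t y _ _ => dkI t y) B B0 iB (fun t y _ _ => Bk t y).
have h2 := @differentiation_under_integral _ _ _ mu k setT measurableT x _ _ Ix
  (fun t _ => ik t) (fun t y _ _ => dkI t y) B B0 iB (fun t y _ _ => Bk t y).
apply: DeriveDef; first exact: h1.
rewrite -derive1E; apply: etrans h2 _; apply: eq_Rintegral => y _; exact: d1k.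
Qed.

Lemma inverse_fourierZ (c : C) G : has_moments G ->
  inverse_fourier (fun y => c * G y) = (fun x => c * inverse_fourier G x).
Proof.
move=> mG; apply/funext => x; rewrite /inverse_fourier.
under eq_cintegral do rewrite mulrCA.
rewrite cintegralZ//; apply: cintegrable_expiM; first exact: measurable_scale.
exact: has_moments_integrable.
Qed.

(** The real parts of inverse Fourier integrals form a class stable under
    differentiation; imaginary parts are real parts for [- 'i * G]. *)
Lemma csmooth_inverse_fourier G : has_moments G -> csmooth (inverse_fourier G).
Proof.
have H : forall u, (exists G, has_moments G /\ u = ReF (inverse_fourier G)) -> smooth u.
  apply: smooth_coind => _ [K [mK ->]].
  exists (ReF (inverse_fourier (fun y => ('i * (2 * pi)%:C) * y%:C * K y))).
    by eexists; split; last reflexivity; exact: has_momentsM.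
  by move=> x; exact: is_derive_Re_inverse_fourier.
move=> mG; split; first by apply: H; exists G.
apply: H; exists (fun y => - 'i * G y); split.
  have [m1 m2] := mG; split; first by apply: cmeasurableM => //; exact: cmeasurable_cst.
  move=> k; have := cintegrableZ (- 'i) (m2 k); congr cintegrable.
  by apply/funext => y; rewrite mulrCA.
rewrite inverse_fourierZ//; apply/funext => x; rewrite /ReF /ImF ReM /=; ring.
Qed.

Lemma has_moments_test f : test_fun f -> has_moments f.
Proof.
move=> tf; split; first exact: test_fun_measurable.
move=> k; apply: test_fun_integrable; apply: test_funM tf.
by apply: csmooth_real; exact: smooth_pow.
Qed.

Lemma fourierE f y : fourier f y = inverse_fourier f ((-1) * y + 0).
Proof.
by apply: eq_cintegral => x; congr (expi _ * _); ring.
Qed.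

Lemma csmooth_fourier f : test_fun f -> csmooth (fourier f).
Proof.
move=> tf; rewrite (_ : fourier f = fun y => inverse_fourier f ((-1) * y + 0)).
  by apply: (@csmooth_affine _ (inverse_fourier f)); apply: csmooth_inverse_fourier;
    exact: has_moments_test.
by apply/funext => y; exact: fourierE.
Qed.

(** The image of a test function under a bounded multiplier is smooth because
    its frequency content decays faster than any power. *)
Lemma has_moments_multiplier (m : R -> C) (M : R) f : cmeasurable m ->
  (forall y, modulus (m y) <= M) -> test_fun f ->
  has_moments (fun y => m y * fourier f y).
Proof.
move=> mm mM tf; have mf := csmooth_measurable (csmooth_fourier tf).
have mmf := cmeasurableM mm mf.
split => // k.
have [K1 h1] := fourier_decay k tf; have [K2 h2] := fourier_decay k.+2 tf.
have M0 : 0 <= M by exact: le_trans (modulus_ge0 _) (mM 0).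
apply: (@le_cintegrable _ _ (fun y => M * (K1 + K2) * (1 + y ^+ 2)^-1)).
- apply: cmeasurableM => //; apply: cmeasurable_real; exact: measurable_funX.
- rewrite /comp; under eq_fun do rewrite EFinM.
  by apply: integrableZl => //; exact: integrable_oneDsqrV.
- move=> y; rewrite !modulusM modulus_real normrX mulrCA -mulrA.
  apply: ler_pM; rewrite ?modulus_ge0 ?mulr_ge0 ?modulus_ge0//.
  rewrite ler_pdivlMr ?ltr_wpDr ?sqr_ge0// mulrDr mulr1.
  apply: lerD; first exact: h1.
  apply: le_trans (h2 y); rewrite le_eqVlt; apply/orP; left; apply/eqP.
  by rewrite -[y ^+ 2]ger0_norm ?sqr_ge0// normrX !exprS; ring.
Qed.

Lemma mult_opE (m : R -> C) f :
  mult_op m f = inverse_fourier (fun y => m y * fourier f y).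
Proof. by []. Qed.

End fourier_of_test_functions.

(** * Fourier inversion at the origin *)

Section inversion_at_the_origin.
Variable R : realType.
Local Notation C := R[i].
Local Notation Re := complex.Re.
Local Notation Im := complex.Im.
Local Notation mu := (@lebesgue_measure R).
Implicit Types f g A B : R -> C.

#[local] Opaque smooth test_fun.

Definition cmeasurable2 (K : R * R -> C) :=
  measurable_fun setT (fun z => Re (K z)) /\ measurable_fun setT (fun z => Im (K z)).

Lemma cmeasurable2M K L : cmeasurable2 K -> cmeasurable2 L ->
  cmeasurable2 (fun z => K z * L z).
Proof.
move=> [f1 f2] [g1 g2]; split.
  under eq_fun do rewrite ReM.
  by apply: measurable_funB; apply: measurable_funM.
under eq_fun do rewrite ImM.
by apply: measurable_funD; apply: measurable_funM.
Qed.

Lemma cmeasurable2_comp f (u : R * R -> R) : cmeasurable f -> measurable_fun setT u ->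
  cmeasurable2 (fun z => f (u z)).
Proof.
by move=> [f1 f2] mu'; split; [exact: (measurableT_comp f1)|exact: (measurableT_comp f2)].
Qed.

Lemma cmeasurable2_expi (u : R * R -> R) : measurable_fun setT u ->
  cmeasurable2 (fun z => expi (u z)).
Proof. by move=> mu'; exact: (cmeasurable2_comp (cmeasurable_expi (@measurable_id _ _ setT)) mu'). Qed.

Lemma measurable_monomial2 (c : R) : measurable_fun setT (fun z : R * R => c * z.1 * z.2).
Proof. by apply: measurable_funM => //; apply: measurable_funM. Qed.

(** Fubini's theorem for the kernel [expi (c * x * y)], whose modulus is 1. *)
Lemma cmultiplication_formula (c : R) A B : cintegrable A -> cintegrable B ->
  cintegral (fun x => A x * cintegral (fun y => expi (c * x * y) * B y)) =
  cintegral (fun y => B y * cintegral (fun x => expi (c * x * y) * A x)).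
Proof.
move=> iA iB.
have [mA mB] := (cintegrable_measurable iA, cintegrable_measurable iB).
pose K (z : R * R) := A z.1 * (expi (c * z.1 * z.2) * B z.2).
have [mK1 mK2] : cmeasurable2 K.
  apply: cmeasurable2M; first exact: (cmeasurable2_comp mA).
  apply: cmeasurable2M; first by apply: cmeasurable2_expi; exact: measurable_monomial2.
  exact: (cmeasurable2_comp mB).
have iB' x : cintegrable (fun y => expi (c * x * y) * B y).
  by apply: cintegrable_expiM => //; exact: measurable_scale.
have iA' y : cintegrable (fun x => expi (c * x * y) * A x).
  by under eq_fun do rewrite mulrAC; apply: cintegrable_expiM => //; exact: measurable_scale.
pose b x := modulus (A x) * \int[mu]_y modulus (B y).
have ib : mu.-integrable setT (EFin \o b).
  rewrite /b /comp; under eq_fun do rewrite EFinM; apply: integrableZr => //.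
  exact: integrable_modulus.
have Kb x : (\int[mu]_y (modulus (K (x, y)))%:E <= (b x)%:E)%E.
  rewrite /b EFinM /Rintegral fineK; last first.
    by apply: integrable_fin_num => //; exact: integrable_modulus.
  rewrite -ge0_integralZl//; last 3 first.
  + by apply/measurable_EFinP; exact: cmeasurable_modulus.
  + by move=> y _; rewrite lee_fin modulus_ge0.
  + by rewrite lee_fin modulus_ge0.
  rewrite le_eqVlt; apply/orP; left; apply/eqP; apply: eq_integral => y _.
  by rewrite /K !modulusM modulus_expi mul1r.
transitivity (cintegral (fun x => cintegral (fun y => K (x, y)))).
  by apply: eq_cintegral => x; rewrite -cintegralZ.
have [_ ->] := cfubini mK1 mK2 ib Kb.
apply: eq_cintegral => y; rewrite -cintegralZ//; apply: eq_cintegral => x.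
by rewrite /K /= mulrA mulrC [A x * _]mulrC.
Qed.

(** The summability factor: an even exponential, whose transform is elementary. *)
Definition abel (y : R) : R := expR (- (2 * pi * `|y|)).

(** On the half-line, [abel] is a decaying exponential and its product with
    [1 + cos] has an elementary primitive. *)
Lemma is_derive_abel_primitive (x y : R) : 0 <= y ->
  is_derive y 1 (fun y => - (2 * pi)^-1 * expR (- (2 * pi) * y + 0) +
    (2 * pi * (1 + x ^+ 2))^-1 * (expR (- (2 * pi) * y + 0) *
      (- 1 * cos (2 * pi * x * y + 0) + x * sin (2 * pi * x * y + 0))))
    ((1 + cos (2 * pi * x * y)) * abel y).
Proof.
move=> y0.
have he := is_derive_comp_affine (is_derive_expR (- (2 * pi) * y + 0)).
have hc := is_derive_comp_affine (is_derive_cos (2 * pi * x * y + 0)).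
have hs := is_derive_comp_affine (is_derive_sin (2 * pi * x * y + 0)).
have h := is_derive_add (is_derive_scale (- (2 * pi)^-1) he)
  (is_derive_scale (2 * pi * (1 + x ^+ 2))^-1
    (is_derive_mul he (is_derive_add (is_derive_scale (- 1) hc) (is_derive_scale x hs)))).
apply: (is_derive_eq h); rewrite /abel !addr0 (ger0_norm y0) (mulNr (2 * pi) y).
have p0 : (pi : R) != 0 by rewrite gt_eqF ?pi_gt0.
have x0 : 1 + x ^+ 2 != 0 by rewrite gt_eqF// ltr_wpDr ?sqr_ge0.
by move: (pi : R) p0 => P p0; field; rewrite x0 p0.
Qed.

Lemma continuous_abel_cos (x : R) : continuous (fun y => (1 + cos (2 * pi * x * y)) * abel y).
Proof.
move=> y; apply: cvgM.
  apply: cvgD; first exact: cvg_cst.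
  apply: (@cvg_comp _ _ _ (fun y => 2 * pi * x * y) cos); last exact: continuous_cos.
  by apply: cvgM; [exact: cvg_cst|exact: cvg_id].
apply: (@cvg_comp _ _ _ (fun y => - (2 * pi * `|y|)) expR); last exact: continuous_expR.
by apply: cvgN; apply: cvgM; [exact: cvg_cst|apply: cvg_norm; exact: cvg_id].
Qed.

(** The summand 1 keeps the integrand nonnegative, so that the improper integral
    is given by the boundary values of the primitive; it is subtracted again in
    [poisson_kernel]. *)
Lemma integral_abel_cos (x : R) :
  (\int[mu]_y ((1 + cos (2 * pi * x * y)) * abel y)%:E =
   (pi^-1 + (pi * (1 + x ^+ 2))^-1)%:E)%E.
Proof.
have k0 y : 0 <= (1 + cos (2 * pi * x * y)) * abel y.
  rewrite mulr_ge0 ?expR_ge0//; have := cos_geN1 (2 * pi * x * y); lra.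
rewrite ge0_symfun_integralT//; first last.
- by move=> y /=; rewrite /abel normrN mulrN cosN.
- exact: continuous_abel_cos.
pose F y := - (2 * pi)^-1 * expR (- (2 * pi) * y + 0) +
    (2 * pi * (1 + x ^+ 2))^-1 * (expR (- (2 * pi) * y + 0) *
      (- 1 * cos (2 * pi * x * y + 0) + x * sin (2 * pi * x * y + 0))).
have p0 : (pi : R) != 0 by rewrite gt_eqF ?pi_gt0.
have x0 : 1 + x ^+ 2 != 0 by rewrite gt_eqF// ltr_wpDr ?sqr_ge0.
rewrite -set_itvcy (@ge0_continuous_FTC2y _ _ F 0 0).
- rewrite -EFinB -EFinM; congr EFin; rewrite /F !mulr0 !addr0 cos0 sin0 expR0.
  by move: (pi : R) p0 => P p0; field; rewrite x0 p0.
- by move=> y _.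
- by apply: continuous_subspaceT; exact: continuous_abel_cos.
- have e0 : expR (- (2 * pi) * y + 0) @[y --> +oo%R] --> (0 : R).
    apply: (@squeeze_cvgr _ _ _ _ (cst 0) (fun y => expR (- y))).
    + near=> y; rewrite expR_ge0/= addr0 ler_expR mulNr lerN2.
      have y0 : 0 <= y by near: y; exact: nbhs_pinfty_ge.
      by rewrite ler_peMl//; have := @pi_ge2 R; lra.
    + exact: cvg_cst.
    + exact: cvgr_expR.
  have b0 : expR (- (2 * pi) * y + 0) * (- 1 * cos (2 * pi * x * y + 0) +
      x * sin (2 * pi * x * y + 0)) @[y --> +oo%R] --> (0 : R).
    apply: norm_cvg0.
    apply: (@squeeze_cvgr _ _ _ _ (cst 0) (fun y => expR (- (2 * pi) * y + 0) * (1 + `|x|))).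
    + near=> y; rewrite normr_ge0/= normrM (ger0_norm (expR_ge0 _)) ler_wpM2l ?expR_ge0//.
      apply: le_trans (ler_normD _ _) _; rewrite !normrM normrN normr1 mul1r.
      apply: lerD; first by rewrite ler_norml cos_geN1 cos_le1.
      by rewrite ler_piMr// ler_norml sin_geN1 sin_le1.
    + exact: cvg_cst.
    + by rewrite -[X in _ --> X](mul0r (1 + `|x|)); apply: cvgM => //; exact: cvg_cst.
  rewrite -[X in _ --> X]addr0 -[X in _ --> X + _](mulr0 (- (2 * pi)^-1)).
  rewrite -[X in _ --> _ + X](mulr0 (2 * pi * (1 + x ^+ 2))^-1).
  by apply: cvgD; apply: cvgM => //; exact: cvg_cst.
- by move=> y y0; apply: ex_derive; exact: (is_derive_abel_primitive x (ltW y0)).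
- apply: cvg_at_right_filter; apply: differentiable_continuous.
  by apply/derivable1_diffP; apply: ex_derive; exact: (is_derive_abel_primitive x (lexx 0)).
- move=> y; rewrite in_itv /= andbT => y0; rewrite derive1E.
  by apply: derive_val; exact: (is_derive_abel_primitive x (ltW y0)).
Unshelve. all: by end_near. Qed.

Lemma measurable_abel : measurable_fun setT abel.
Proof.
apply: continuous_measurable_fun => y.
apply: (@cvg_comp _ _ _ (fun y => - (2 * pi * `|y|)) expR); last exact: continuous_expR.
by apply: cvgN; apply: cvgM; [exact: cvg_cst|apply: cvg_norm; exact: cvg_id].
Qed.

Lemma abel_ge0_le1 y : 0 <= abel y <= 1.
Proof. by rewrite expR_ge0/= expR_le1 oppr_le0 mulr_ge0// mulr_ge0// pi_ge0. Qed.

Lemma integrable_abel_cos x :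
  mu.-integrable setT (fun y => ((1 + cos (2 * pi * x * y)) * abel y)%:E).
Proof.
apply/integrableP; split.
  by apply/measurable_EFinP; apply: continuous_measurable_fun; exact: continuous_abel_cos.
under eq_integral => y _.
  rewrite gee0_abs; last first.
    rewrite lee_fin mulr_ge0 ?expR_ge0//; have := cos_geN1 (2 * pi * x * y); lra.
  over.
by rewrite integral_abel_cos ltry.
Qed.

Lemma integrable_abel : mu.-integrable setT (fun y => (abel y)%:E).
Proof.
apply: (@le_integrable _ _ _ mu setT measurableT _ _ _ _ (integrable_abel_cos 0)).
  by apply/measurable_EFinP; exact: measurable_abel.
move=> y _; rewrite mulr0 mul0r cos0 lee_fin.
have /andP[h _] := abel_ge0_le1 y.
by rewrite normrM ler_peMl// ger0_norm//; lra.
Qed.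

(** The transform of the Abel factor is the Poisson kernel. *)
Lemma poisson_kernel (x : R) :
  cintegral (fun y => expi (- (2 * pi) * x * y) * (abel y)%:C) =
  ((pi * (1 + x ^+ 2))^-1)%:C.
Proof.
have Iabel : \int[mu]_y abel y = pi^-1.
  have := integral_abel_cos 0; under eq_integral do rewrite mulr0 mul0r cos0 EFinM.
  rewrite integralZl//; last exact: integrable_abel.
  rewrite -(fineK (integrable_fin_num measurableT integrable_abel)) -EFinM.
  rewrite expr0n addr0 mulr1 => -[].
  by rewrite -/(Rintegral mu setT abel); lra.
apply: complex_ext; rewrite /cintegral /=.
  transitivity (\int[mu]_y ((1 + cos (2 * pi * x * y)) * abel y - abel y)).
    apply: eq_Rintegral => y _; rewrite /ReF ReM /= !mulNr cosN; ring.
  rewrite RintegralB//; [|exact: integrable_abel_cos|exact: integrable_abel].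
  by rewrite Iabel /Rintegral integral_abel_cos /=; ring.
pose s := ImF (fun y => expi (- (2 * pi) * x * y) * (abel y)%:C).
have [_ ims] : cintegrable (fun y => expi (- (2 * pi) * x * y) * (abel y)%:C).
  apply: cintegrable_expiM; first exact: measurable_scale.
  by split; [exact: integrable_abel|exact: integrable0].
(* The imaginary part vanishes because its integrand is odd. *)
have n1 : (- 1 : R) != 0 by rewrite oppr_eq0 oner_eq0.
have := Rintegral_affine 0 n1 ims; rewrite normrN normr1 invr1 mul1r -/s.
have -> : \int[mu]_y s (- 1 * y + 0) = \int[mu]_y (- 1 * s y).
  apply: eq_Rintegral => y _.
  by rewrite /s /ImF !ImM /abel addr0 mulN1r normrN /= mulrN sinN; ring.
by rewrite RintegralZl//; lra.
Qed.

Lemma ccvg_unique (u : nat -> C) l k : ccvg u l -> ccvg u k -> l = k.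
Proof.
move=> [u1 u2] [v1 v2]; apply: complex_ext.
  exact: cvg_unique u1 v1.
exact: cvg_unique u2 v2.
Qed.

Lemma cvg_harmonic0 : (n.+1%:R^-1 : R) @[n --> \oo] --> (0 : R).
Proof. exact: cvg_harmonic. Qed.

Lemma cintegrable_abel (e : R) : e != 0 -> cintegrable (fun y => (abel (e * y + 0))%:C).
Proof.
move=> e0; apply: (@cintegrable_affine _ e 0 (fun y => (abel y)%:C)) => //.
by split; [exact: integrable_abel|exact: integrable0].
Qed.

Lemma fourier_abel (e x : R) : 0 < e ->
  cintegral (fun y => expi (- (2 * pi) * x * y) * (abel (e * y + 0))%:C) =
  (e^-1 * (pi * (1 + (e^-1 * x + 0) ^+ 2))^-1)%:C.
Proof.
move=> e0; have e1 : e != 0 by rewrite gt_eqF.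
pose g y := expi (- (2 * pi) * (e^-1 * x) * y) * (abel y)%:C.
have ig : cintegrable g.
  apply: cintegrable_expiM; first exact: measurable_scale.
  by split; [exact: integrable_abel|exact: integrable0].
have := cintegral_affine 0 e1 ig; rewrite /g poisson_kernel gtr0_norm// -realCM addr0.
move=> <-; apply: eq_cintegral => y; congr (expi _ * _).
by rewrite addr0; field.
Qed.

(** Fourier inversion at a point, by Abel summation: the integrals of
    [fourier f y * exp (- 2 pi e |y|)] tend to the integral of [fourier f] as [e]
    tends to 0, and are averages of [f] against dilated Poisson kernels, which
    concentrate at 0 and have mass 1. *)
Theorem fourier_inversion0 f : test_fun f -> cintegral (fourier f) = f 0.
Proof.
move=> tf; have iff := test_fun_integrable tf.
have sf := csmooth_fourier tf.
pose e n : R := n.+1%:R^-1.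
have e0 n : 0 < e n by rewrite invr_gt0 ltr0n.
have mom : has_moments (fourier f).
  have := @has_moments_multiplier _ (fun=> 1) 1 f (cmeasurable_cst 1) _ tf.
  under eq_fun do rewrite mul1r.
  by apply=> _; rewrite (modulus_real 1) normr1.
have iF := has_moments_integrable mom.
pose A n := cintegral (fun y => (abel (e n * y + 0))%:C * fourier f y).
(* As [e n] tends to 0 the Abel factor tends to 1. *)
have A1 : ccvg A (cintegral (fourier f)).
  apply: (@cintegral_dominated _ _ _ (fun y => modulus (fourier f y))).
  - move=> n; apply: cmeasurableM (cintegrable_measurable iF).
    apply: cintegrable_measurable; apply: cintegrable_abel; exact: lt0r_neq0.
  - move=> y; rewrite -[X in ccvg _ X]mul1r; apply: ccvgM; last exact: ccvg_cst.
    have h : - (2 * pi * `|e n * y + 0|) @[n --> \oo] --> (0 : R).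
      rewrite -[X in _ --> X]oppr0 -[X in _ --> - X](mulr0 (2 * pi)).
      apply: cvgN; apply: cvgM; first exact: cvg_cst.
      rewrite -[X in _ --> X](@normr0 _ R); apply: cvg_norm.
      rewrite -[X in _ --> X]addr0 -[X in _ --> X + _](mul0r y).
      by apply: cvgD; [apply: cvgM; [exact: cvg_harmonic0|exact: cvg_cst]|exact: cvg_cst].
    apply: cvgC; rewrite -[X in _ --> X]expR0.
    by apply: (cvg_comp _ _ h); exact: continuous_expR.
  - exact: integrable_modulus.
  - move=> n y; rewrite modulusM modulus_real ler_piMl ?modulus_ge0//.
    by have /andP[h1 h2] := abel_ge0_le1 (e n * y + 0); rewrite ger0_norm.
(* The transform moves onto the Abel factor, where it is a Poisson kernel. *)
have AE n : A n = cintegral (fun x => f (e n * x + 0) * ((pi * (1 + x ^+ 2))^-1)%:C).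
  have e1 := lt0r_neq0 (e0 n).
  have := cmultiplication_formula (- (2 * pi)) iff (cintegrable_abel e1).
  under eq_cintegral do rewrite fourier_abel//.
  have -> : cintegral (fun y => (abel (e n * y + 0))%:C *
      cintegral (fun x => expi (- (2 * pi) * x * y) * f x)) = A n.
    apply: eq_cintegral => y; congr (_ * _); apply: eq_cintegral => x.
    by congr (expi _ * _); ring.
  move=> <-.
  pose g x := f x * ((pi * (1 + ((e n)^-1 * x + 0) ^+ 2))^-1)%:C.
  have ig : cintegrable g.
    rewrite /g; under eq_fun do rewrite mulrC.
    apply: (@cintegrableM_bounded _ _ _ pi^-1) => //.
      apply: cmeasurable_real; apply: continuous_measurable_fun => x.
      apply: cvgV; first by rewrite mulf_neq0// gt_eqF// ?pi_gt0// ltr_wpDr ?sqr_ge0.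
      apply: cvgM; first exact: cvg_cst.
      apply: cvgD; first exact: cvg_cst.
      rewrite expr2; under eq_fun do rewrite expr2.
      by apply: cvgM; apply: cvgD; do ?exact: cvg_cst; apply: cvgM => //; exact: cvg_cst.
    move=> x; rewrite modulus_real ger0_norm; last first.
      by rewrite invr_ge0 mulr_ge0 ?pi_ge0// addr_ge0// sqr_ge0.
    rewrite lef_pV2 ?posrE ?pi_gt0// ?mulr_gt0 ?pi_gt0// ?ltr_wpDr ?sqr_ge0//.
    by rewrite ler_peMr ?pi_ge0// lerDl sqr_ge0.
  have := cintegral_affine 0 e1 ig; rewrite gtr0_norm// -cintegralZ// /g => h.
  transitivity (cintegral (fun x => ((e n)^-1)%:C * g x)).
    by apply: eq_cintegral => x; rewrite realCM mulrCA.
  rewrite -h; apply: eq_cintegral => x; congr (_ * _%:C).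
  by rewrite [(e n)^-1 * _ + 0]addr0 addr0 mulKf.
have A2 : ccvg A (cintegral (fun x => f 0 * ((pi * (1 + x ^+ 2))^-1)%:C)).
  have -> : A = fun n => cintegral (fun x => f (e n * x + 0) * ((pi * (1 + x ^+ 2))^-1)%:C).
    by apply/funext.
  have [K fK] := test_fun_bounded tf.
  have mP : cmeasurable (fun x : R => ((pi * (1 + x ^+ 2))^-1)%:C).
    apply: cmeasurable_real; under eq_fun do rewrite invfM.
    by apply: measurable_funM => //; exact: measurable_oneDsqrV.
  apply: (@cintegral_dominated _ _ _ (fun x => K * pi^-1 * (1 + x ^+ 2)^-1)).
  - move=> n; apply: cmeasurableM => //.
    by apply: cmeasurable_affine; exact: test_fun_measurable.
  - move=> x; apply: ccvgM; last exact: ccvg_cst.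
    have h0 : e n * x + 0 @[n --> \oo] --> (0 : R).
      rewrite -[X in _ --> X]addr0 -[X in _ --> X + _](mul0r x).
      by apply: cvgD; [apply: cvgM; [exact: cvg_harmonic0|exact: cvg_cst]|exact: cvg_cst].
    have /test_funP[[s1 s2] _] := tf.
    by split; [exact: (cvg_comp _ _ h0 (smooth_continuous s1 (x := 0)))|
      exact: (cvg_comp _ _ h0 (smooth_continuous s2 (x := 0)))].
  - rewrite /comp; under eq_fun do rewrite EFinM.
    by apply: integrableZl => //; exact: integrable_oneDsqrV.
  - move=> n x; rewrite modulusM modulus_real -mulrA ler_pM ?modulus_ge0//.
    by rewrite ger0_norm ?invfM// mulr_ge0 ?invr_ge0 ?pi_ge0// addr_ge0 ?sqr_ge0.
rewrite (ccvg_unique A1 A2) cintegralZ; last first.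
  split; last exact: integrable0.
  rewrite /comp /ReF /=; under eq_fun do rewrite invfM EFinM.
  by apply: integrableZl => //; exact: integrable_oneDsqrV.
rewrite -[RHS]mulr1; congr (_ * _); apply: complex_ext; rewrite /cintegral /=.
  transitivity (\int[mu]_x (pi^-1 * (1 + x ^+ 2)^-1)).
    by apply: eq_Rintegral => x _; rewrite /ReF /= invfM.
  rewrite RintegralZl//; last exact: integrable_oneDsqrV.
  by rewrite /Rintegral integral_oneDsqrV /= mulVf// gt_eqF// pi_gt0.
by rewrite /Rintegral /ImF /= integral0.
Qed.

End inversion_at_the_origin.

(** * Lebesgue norms of complex functions *)

Section Lebesgue_norms.
Variable R : realType.
Local Notation C := R[i].
Local Notation mu := (@lebesgue_measure R).
Variable p : R.
Hypothesis p1 : 1 < p.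
Implicit Types f g : R -> C.

#[local] Opaque smooth test_fun.

Let p0 : 0 < p. Proof. exact: lt_trans p1. Qed.
Let pn0 : p != 0. Proof. exact: lt0r_neq0. Qed.

Definition power_integral f : \bar R := (\int[mu]_x (modulus (f x) `^ p)%:E)%E.

Lemma power_integral_ge0 f : (0 <= power_integral f)%E.
Proof. by apply: integral_ge0 => x _; rewrite lee_fin powR_ge0. Qed.

Lemma Lp_normE f : Lp_norm p%:E f = (power_integral f `^ p^-1)%E.
Proof.
rewrite /Lp_norm.
have -> F : Lnorm mu p%:E F = ((\int[mu]_x `|F x| `^ p) `^ p^-1)%E by rewrite unlock.
apply: (congr1 (fun z => z `^ p^-1)%E).
by apply: eq_integral => x _; rewrite /= ger0_norm// modulus_ge0.
Qed.

Lemma Lp_norm_power f : (Lp_norm p%:E f `^ p)%E = power_integral f.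
Proof.
by rewrite Lp_normE -poweRrM mulVf// poweRe1// power_integral_ge0.
Qed.

Lemma Lp_norm_ge0 f : (0 <= Lp_norm p%:E f)%E.
Proof. exact: Lnorm_ge0. Qed.

Let in0y (z : \bar R) : (0 <= z)%E -> z \in `[0%E, +oo%E].
Proof. by move=> z0; rewrite in_itv /= z0 leey. Qed.

Lemma Lp_norm_leP f (K : \bar R) : (0 <= K)%E ->
  (Lp_norm p%:E f <= K)%E <-> (power_integral f <= K `^ p)%E.
Proof.
move=> K0; split=> [fK|fK].
  rewrite -Lp_norm_power; apply: gt0_ler_poweR => //; first exact: ltW.
    by apply: in0y; exact: Lp_norm_ge0.
  exact: in0y.
rewrite Lp_normE -[K]poweRe1// -(mulfV pn0) poweRrM.
apply: gt0_ler_poweR => //; first by rewrite invr_ge0 ltW.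
  by apply: in0y; exact: power_integral_ge0.
by apply: in0y; exact: poweR_ge0.
Qed.

Lemma measurable_power f : cmeasurable f ->
  measurable_fun setT (fun x => (modulus (f x) `^ p)%:E).
Proof.
move=> mf; apply/measurable_EFinP.
apply: (measurableT_comp (f := fun x => x `^ p)); first exact: measurable_powR.
exact: cmeasurable_modulus.
Qed.

Lemma le_Lp_norm f g : cmeasurable f -> cmeasurable g ->
  (forall x, modulus (f x) <= modulus (g x)) ->
  (Lp_norm p%:E f <= Lp_norm p%:E g)%E.
Proof.
move=> mf mg fg; apply/Lp_norm_leP; first exact: Lp_norm_ge0.
rewrite Lp_norm_power; apply: ge0_le_integral => //.
- by move=> x _; rewrite lee_fin powR_ge0.
- exact: measurable_power.
- exact: measurable_power.
- move=> x _; rewrite lee_fin ge0_ler_powR ?nnegrE ?modulus_ge0//.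
  exact: ltW.
Qed.

Lemma eq_Lp_norm f g : (forall x, modulus (f x) = modulus (g x)) ->
  Lp_norm p%:E f = Lp_norm p%:E g.
Proof.
move=> fg; rewrite !Lp_normE; apply: (congr1 (fun z => z `^ p^-1)%E).
by apply: eq_integral => x _; rewrite fg.
Qed.

Lemma Lp_normD f g : cmeasurable f -> cmeasurable g ->
  (Lp_norm p%:E (fun x => (f x + g x)%R) <= Lp_norm p%:E f + Lp_norm p%:E g)%E.
Proof.
move=> mf mg.
pose s x : C := (modulus (f x) + modulus (g x))%:C.
have ms : cmeasurable s.
  by apply: cmeasurable_real; apply: measurable_funD; exact: cmeasurable_modulus.
apply: le_trans (le_Lp_norm (cmeasurableD mf mg) ms _) _.
  move=> x; rewrite modulus_real ger0_norm ?addr_ge0 ?modulus_ge0//.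
  exact: ler_modulusD.
have := @minkowski_EFin _ _ _ mu (fun x => modulus (f x)) (fun x => modulus (g x)) p
  (cmeasurable_modulus mf) (cmeasurable_modulus mg) (ltW p1).
apply: le_trans; rewrite /Lp_norm le_eqVlt; apply/orP; left; apply/eqP.
apply: eq_Lnorm => x /=; rewrite modulus_real ger0_norm ?addr_ge0 ?modulus_ge0//.
Qed.

Lemma Lp_normZ (c : C) f : cmeasurable f ->
  Lp_norm p%:E (fun x => (c * f x)%R) = ((modulus c)%:E * Lp_norm p%:E f)%E.
Proof.
move=> mf; rewrite !Lp_normE /power_integral.
under eq_integral do rewrite modulusM powRM ?modulus_ge0// EFinM.
rewrite ge0_integralZl//; last 3 first.
- exact: measurable_power.
- by move=> x _; rewrite lee_fin powR_ge0.
- by rewrite lee_fin powR_ge0.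
rewrite poweRM ?lee_fin ?powR_ge0//; last exact: power_integral_ge0.
by rewrite poweR_EFin -powRrM mulfV// powRr1// modulus_ge0.
Qed.

Lemma Lp_norm0 : Lp_norm p%:E (fun=> 0 : C) = 0%E.
Proof.
rewrite Lp_normE /power_integral.
under eq_integral do rewrite modulus0 powR0//.
by rewrite integral0 poweR0r// invr_eq0.
Qed.

Lemma Lp_norm_eq0 f : cmeasurable f -> Lp_norm p%:E f = 0%E ->
  {ae mu, forall x, f x = 0}.
Proof.
move=> mf f0.
have mE : measurable_fun setT (fun x => (modulus (f x))%:E).
  by apply/measurable_EFinP; exact: cmeasurable_modulus.
have pE : (0 < p%:E)%E by rewrite lte_fin.
have := @Lnorm_eq0_eq0 _ _ _ mu (fun x => (modulus (f x))%:E) p%:E mE pE f0.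
by apply: ae_mono => x /(_ I) [/modulus0_eq0].
Qed.

(** At a positive limit the power is differentiable. At 0 it is dominated by the
    identity, because the exponent exceeds 1. *)
Lemma cvg_powR (u : nat -> R) l : (forall n, 0 <= u n) ->
  u n @[n --> \oo] --> l -> u n `^ p @[n --> \oo] --> l `^ p.
Proof.
move=> u0 ul.
have l0 : 0 <= l by apply: (cvgr_to_ge ul); exact: nearW.
have [l_eq0|ln0] := eqVneq l 0; last first.
  have lp : 0 < l by rewrite lt0r ln0.
  have cp : {for l, continuous (fun a : R => a `^ p)}.
    apply: differentiable_continuous; apply/derivable1_diffP.
    by apply: derivable_powR; rewrite in_itv /= andbT.
  exact: (cvg_comp _ _ ul cp).
move: ul; rewrite l_eq0 powR0// => ul.
apply: (@squeeze_cvgr _ _ _ _ (cst 0) u) => //; last exact: cvg_cst.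
near=> n; rewrite powR_ge0/=.
have un1 : u n <= 1 by near: n; move/cvgr_le : ul; apply; exact: ltr01.
have [->|un0] := eqVneq (u n) 0; first by rewrite powR0.
by apply: ge1r_powR; [rewrite lt0r un0 u0|exact: ltW].
Unshelve. all: by end_near. Qed.

(** Only upper bounds of norms have to pass to pointwise limits, so Fatou's lemma
    suffices where one might expect convergence in norm. *)
Lemma Lp_norm_fatou (f_ : nat -> R -> C) f (K : \bar R) : (0 <= K)%E ->
  (forall n, cmeasurable (f_ n)) -> cmeasurable f ->
  (forall x, ccvg (f_ ^~ x) (f x)) ->
  (forall n, (Lp_norm p%:E (f_ n) <= K)%E) -> (Lp_norm p%:E f <= K)%E.
Proof.
move=> K0 mf_ mf cf fK; apply/Lp_norm_leP => //.
pose g n x := (modulus (f_ n x) `^ p)%:E.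
have gl x : limn_einf (g ^~ x) = (modulus (f x) `^ p)%:E.
  have h : g n x @[n --> \oo] --> (modulus (f x) `^ p)%:E.
    apply: cvg_EFin; first exact: nearW.
    apply: cvg_powR; first by move=> n; exact: modulus_ge0.
    exact: ccvg_modulus.
  by have [-> _] := cvg_limn_einf_sup h.
rewrite /power_integral; under eq_integral do rewrite -gl.
have mg n : measurable_fun setT (g n) by exact: measurable_power.
have g0 n x : setT x -> (0 <= g n x)%E by move=> _; rewrite lee_fin powR_ge0.
apply: le_trans (@fatou _ _ _ mu setT measurableT g mg g0) _.
rewrite limn_einf_lim; apply: lime_le; first exact: is_cvg_einfs.
apply: nearW => n; apply: le_trans (_ : (\int[mu]_x g n x <= _)%E).
  by apply: ereal_inf_lbound; exists n => /=.
by have /(Lp_norm_leP _ K0) := fK n.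
Qed.

Lemma Lp_norm_affine (a b : R) f : a != 0 -> cmeasurable f ->
  Lp_norm p%:E (fun x => f (a * x + b)%R) = ((`|a|^-1 `^ p^-1)%:E * Lp_norm p%:E f)%E.
Proof.
move=> a0 mf; rewrite !Lp_normE -poweR_EFin -poweRM ?lee_fin ?invr_ge0//; last first.
  exact: power_integral_ge0.
apply: (congr1 (fun z => z `^ p^-1)%E); rewrite /power_integral [in RHS](ge0_integral_affine b a0 (measurable_power mf)).
  by rewrite muleA -EFinM mulVf ?normr_eq0// mul1e.
by move=> x; rewrite lee_fin powR_ge0.
Qed.

Lemma test_fun_Lp f : test_fun f -> (Lp_norm p%:E f < +oo)%E.
Proof.
move=> tf; have [K [M [K0 M0 fK]]] := test_fun_dominated tf.
rewrite Lp_normE; apply: poweR_lty.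
apply: (@le_lt_trans _ _ (\int[mu]_x ((K `^ p) * \1_(`[- M, M]%classic) x)%:E)%E).
  apply: ge0_le_integral => //.
  - by move=> x _; rewrite lee_fin powR_ge0.
  - by apply: measurable_power; exact: test_fun_measurable.
  - by apply: measurable_int; exact: (integrable_indic_segment (K `^ p) M).
  - move=> x _; rewrite lee_fin; have := fK x; rewrite indicE.
    case: (x \in _); rewrite ?mulr1 ?mulr0 => h.
      by rewrite ge0_ler_powR ?nnegrE ?modulus_ge0// ltW.
    have -> : modulus (f x) = 0 by apply/eqP; rewrite eq_le h modulus_ge0.
    by rewrite powR0.
have := integrable_indic_segment (K `^ p) M => /(integrable_fin_num measurableT).
by rewrite fin_numElt => /andP[].
Qed.

End Lebesgue_norms.

(** * Multiplier operators on test functions *)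

Section operator_norms.
Variable R : realType.
Local Notation C := R[i].
Local Notation Re := complex.Re.
Local Notation Im := complex.Im.
Local Notation mu := (@lebesgue_measure R).
Variable p : R.
Hypothesis p1 : 1 < p.
Implicit Types f g m : R -> C.

#[local] Opaque smooth test_fun.

(** A bound at every point, not just almost everywhere, so that dominated
    convergence may be applied along dilations of [m]; see [truncate]. *)
Definition bounded_symbol m :=
  cmeasurable m /\ exists M, forall y, modulus (m y) <= M.

Lemma cintegrable_multiplier m f : bounded_symbol m -> test_fun f ->
  cintegrable (fun y => m y * fourier f y).
Proof.
by move=> [mm [M mM]] tf; apply: has_moments_integrable; exact: has_moments_multiplier.
Qed.

Lemma csmooth_mult_op m f : bounded_symbol m -> test_fun f -> csmooth (mult_op m f).
Proof.
move=> [mm [M mM]] tf; rewrite mult_opE; apply: csmooth_inverse_fourier.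
exact: has_moments_multiplier.
Qed.

Lemma measurable_mult_op m f : bounded_symbol m -> test_fun f -> cmeasurable (mult_op m f).
Proof. by move=> bm tf; apply: csmooth_measurable; exact: csmooth_mult_op. Qed.

Lemma cintegrable_fourier_integrand f y : test_fun f ->
  cintegrable (fun x => expi (- (2 * pi * x * y)) * f x).
Proof.
move=> tf; under eq_fun do rewrite fourier_phaseE.
apply: cintegrable_expiM; first exact: measurable_scale.
exact: test_fun_integrable.
Qed.

Lemma mult_opZ m f (c : C) x : bounded_symbol m -> test_fun f ->
  mult_op m (fun t => c * f t) x = c * mult_op m f x.
Proof.
move=> bm tf; rewrite /mult_op -cintegralZ; last first.
  apply: cintegrable_expiM; first exact: measurable_scale.
  exact: cintegrable_multiplier.
apply: eq_cintegral => y; rewrite -[RHS]mulrCA; congr (_ * _).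
rewrite mulrCA; congr (_ * _); rewrite /fourier -cintegralZ.
  by apply: eq_cintegral => t; rewrite mulrCA.
exact: cintegrable_fourier_integrand.
Qed.

Lemma mult_opD m f g x : bounded_symbol m -> test_fun f -> test_fun g ->
  mult_op m (fun t => f t + g t) x = mult_op m f x + mult_op m g x.
Proof.
move=> bm tf tg; rewrite /mult_op -cintegralD; last 2 first.
- apply: cintegrable_expiM; first exact: measurable_scale.
  exact: cintegrable_multiplier.
- apply: cintegrable_expiM; first exact: measurable_scale.
  exact: cintegrable_multiplier.
apply: eq_cintegral => y; rewrite -!mulrDr; congr (_ * (_ * _)).
rewrite /fourier -cintegralD; do ?exact: cintegrable_fourier_integrand.
by apply: eq_cintegral => t; rewrite mulrDr.
Qed.

Lemma fourier_ae0 f y : test_fun f -> {ae mu, forall x, f x = 0} -> fourier f y = 0.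
Proof.
move=> tf f0; rewrite /fourier (@ae_eq_cintegral _ _ (fun=> 0)).
- by apply: complex_ext; rewrite /cintegral /= /Rintegral integral0.
- by apply: cintegrable_measurable; exact: cintegrable_fourier_integrand.
- exact: cmeasurable_cst.
- by apply: ae_mono f0 => x ->; rewrite mulr0.
Qed.

Lemma mult_op_eq0 m f x : test_fun f -> Lp_norm p%:E f = 0%E -> mult_op m f x = 0.
Proof.
move=> tf f0; have ae0 := Lp_norm_eq0 p1 (test_fun_measurable tf) f0.
rewrite /mult_op (@eq_cintegral _ _ (fun=> 0)).
  by apply: complex_ext; rewrite /cintegral /= /Rintegral integral0.
by move=> y; rewrite fourier_ae0// !mulr0.
Qed.

Definition cbump (x : R) : C := (bump x)%:C.

Lemma test_cbump : test_fun cbump.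
Proof.
apply/test_funP; split; first by apply: csmooth_real; exact: smooth_bump.
by exists 1 => x /bump_out h; rewrite /cbump h.
Qed.

Lemma cbump0 : cbump 0 = 1.
Proof. by rewrite /cbump bump0. Qed.

Lemma modulus_cbump_le1 x : modulus (cbump x) <= 1.
Proof.
by have /andP[h1 h2] := @bump_ge0_le1 R x; rewrite modulus_real ger0_norm.
Qed.

(** A null function has zero transform, whereas by inversion the transform of the
    bump has integral 1. *)
Lemma Lp_norm_cbump_neq0 : Lp_norm p%:E cbump != 0%E.
Proof.
apply/eqP => h0; have ae0 := Lp_norm_eq0 p1 (test_fun_measurable test_cbump) h0.
have := fourier_inversion0 test_cbump; rewrite cbump0.
rewrite (@eq_cintegral _ _ (fun=> 0)); last first.
  by move=> y; rewrite fourier_ae0//; exact: test_cbump.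
move=> /(congr1 (fun z : C => Re z)); rewrite /cintegral /= /Rintegral integral0 /= => /eqP.
by rewrite eq_sym oner_eq0.
Qed.

Lemma mult_opLp_test m f : bounded_symbol m -> test_fun f ->
  mult_opLp p m f (mult_op m f).
Proof.
move=> bm tf; split.
- split; first exact: test_fun_measurable.
  exact: (test_fun_Lp p1 tf).
- exact: measurable_mult_op.
- exists (fun=> f); split => //.
    rewrite (_ : (fun n => _) = fun=> 0%E); first exact: cvg_cst.
    by apply/funext => n; under eq_fun do rewrite subrr; exact: Lp_norm0.
  rewrite (_ : (fun n => _) = fun=> 0%E); first exact: cvg_cst.
  by apply/funext => n; under eq_fun do rewrite subrr; exact: Lp_norm0.
Qed.

(** Homogeneity reduces an operator bound to functions of norm one. When [f] has
    norm 0 its image vanishes, and the bound holds even for [S] infinite, as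
    [+oo * 0 = 0]. *)
Lemma normalized_bound m f (S : \bar R) : bounded_symbol m -> test_fun f ->
  (forall c : R, Lp_norm p%:E (fun x => c%:C * f x) = 1%E ->
    (Lp_norm p%:E (mult_op m (fun x => (c%:C * f x)%R)) <= S)%E) ->
  (Lp_norm p%:E (mult_op m f) <= S * Lp_norm p%:E f)%E.
Proof.
move=> bm tf H.
have [f0|f0] := eqVneq (Lp_norm p%:E f) 0%E.
  rewrite f0 mule0 (_ : mult_op m f = fun=> 0) ?(Lp_norm0 p1)//.
  by apply/funext => x; exact: mult_op_eq0.
have Nfin : Lp_norm p%:E f \is a fin_num.
  by rewrite ge0_fin_numE ?Lp_norm_ge0//; exact: (test_fun_Lp p1 tf).
have mf := test_fun_measurable tf.
have mT := measurable_mult_op bm tf.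
pose c := fine (Lp_norm p%:E f).
have NE : Lp_norm p%:E f = c%:E by rewrite fineK.
have cp : 0 < c by rewrite -lte_fin -NE lt0e f0 Lp_norm_ge0.
have := H c^-1; rewrite (Lp_normZ p1 _ mf) modulus_real gtr0_norm ?invr_gt0//.
rewrite NE -EFinM mulVf ?gt_eqF// => /(_ erefl).
rewrite (_ : mult_op m _ = fun x => (c^-1)%:C * mult_op m f x); last first.
  by apply/funext => x; exact: mult_opZ.
rewrite (Lp_normZ p1 _ mT) modulus_real gtr0_norm ?invr_gt0//.
by rewrite lee_pdivrMl// muleC.
Qed.

Lemma mult_norm_ge m f : bounded_symbol m -> test_fun f ->
  (Lp_norm p%:E (mult_op m f) <= mult_norm p m * Lp_norm p%:E f)%E.
Proof.
move=> bm tf; apply: normalized_bound => // c fc.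
apply: ereal_sup_ubound; eexists; eexists; split; last reflexivity; last exact: fc.
by apply: mult_opLp_test => //; exact: test_funZ.
Qed.

Lemma mult_normR_ge m f : bounded_symbol m -> test_fun f -> real_valued f ->
  (Lp_norm p%:E (mult_op m f) <= mult_normR p m * Lp_norm p%:E f)%E.
Proof.
move=> bm tf rf; apply: normalized_bound => // c fc.
apply: ereal_sup_ubound; eexists; eexists; split; last reflexivity; last exact: fc.
  by move=> x; rewrite ImM rf /= mulr0 mul0r addr0.
by apply: mult_opLp_test => //; exact: test_funZ.
Qed.

(** The supremum could only be negative over an empty set; the bump shows that
    it is not empty. *)
Lemma mult_normR_ge0 m : bounded_symbol m -> (0 <= mult_normR p m)%E.
Proof.
move=> bm; rewrite leNgt; apply/negP => h.
have := mult_normR_ge bm test_cbump (fun x => erefl).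
have N0 : (0 < Lp_norm p%:E cbump)%E by rewrite lt0e Lp_norm_cbump_neq0 Lp_norm_ge0.
by rewrite leNgt; apply/negP/negPn; apply: lt_le_trans (Lp_norm_ge0 _ _); rewrite mule_lt0_gt0.
Qed.

Lemma mult_norm_ge0 m : bounded_symbol m -> (0 <= mult_norm p m)%E.
Proof.
move=> bm; rewrite leNgt; apply/negP => h.
have := mult_norm_ge bm test_cbump.
have N0 : (0 < Lp_norm p%:E cbump)%E by rewrite lt0e Lp_norm_cbump_neq0 Lp_norm_ge0.
by rewrite leNgt; apply/negP/negPn; apply: lt_le_trans (Lp_norm_ge0 _ _); rewrite mule_lt0_gt0.
Qed.

(** The shape of estimate that arises when an operator bound passes from test
    functions to their limits: [e] and [d] are the errors before and after
    applying the operator. *)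
Lemma le_of_vanishing_errors (x : \bar R) (k : R) (e d : nat -> \bar R) :
  (forall n, (x <= d n + (k%:E * (1 + e n) + k%:E * e n))%E) ->
  e n @[n --> \oo] --> 0%E -> d n @[n --> \oo] --> 0%E -> (x <= k%:E)%E.
Proof.
move=> H e0 d0.
have : (d n + (k%:E * (1 + e n) + k%:E * e n))%E @[n --> \oo] --> k%:E.
  rewrite -[X in _ --> X]add0e; apply: cvgeD => //.
  rewrite -[X in _ --> X]adde0; apply: cvgeD => //; last first.
    by rewrite -[X in _ --> X](mule0 k%:E); apply: cvgeZl.
  rewrite -[X in _ --> X]mule1; apply: cvgeZl => //.
  by rewrite -[X in _ --> X]adde0; apply: cvgeD => //; exact: cvg_cst.
by move/cvge_to_ge; apply; exact: nearW.
Qed.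

End operator_norms.

(** * Operator norms and dilations *)

Section operator_norm_bounds.
Variable R : realType.
Local Notation C := R[i].
Local Notation Re := complex.Re.
Local Notation Im := complex.Im.
Local Notation mu := (@lebesgue_measure R).
Variable p : R.
Hypothesis p1 : 1 < p.
Implicit Types f g m : R -> C.

#[local] Opaque smooth test_fun.

Lemma Lp_normB_sym f g :
  Lp_norm p%:E (fun x => f x - g x) = Lp_norm p%:E (fun x => g x - f x).
Proof. by apply: eq_Lp_norm => x; rewrite -modulusN opprB. Qed.

Lemma Lp_norm_triangle f g : cmeasurable f -> cmeasurable g ->
  (Lp_norm p%:E g <= Lp_norm p%:E (fun x => (f x - g x)%R) + Lp_norm p%:E f)%E.
Proof.
move=> mf mg; rewrite Lp_normB_sym.
have := Lp_normD p1 (cmeasurableD mg (cmeasurableN mf)) mf.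
by under [X in (Lp_norm _ X <= _)%E -> _]eq_fun do rewrite subrK.
Qed.

(** An operator bound on test functions controls the extended operator, since the
    images of the approximants converge in norm by definition. *)
Lemma mult_norm_le m (K : \bar R) : bounded_symbol m -> (0 <= K)%E ->
  (forall f, test_fun f -> (Lp_norm p%:E (mult_op m f) <= K * Lp_norm p%:E f)%E) ->
  (mult_norm p m <= K)%E.
Proof.
move=> bm K0 HK; apply: ge_ereal_sup => _ [f [g [[[mf _] mg [f_ [tf_ ff gg]]] f1 ->]]].
case: K K0 HK => [k|_ _|//]; last by rewrite leey.
rewrite lee_fin => k0 HK; apply: le_of_vanishing_errors ff gg => n.
have mfn := test_fun_measurable (tf_ n).
have mTn := measurable_mult_op bm (tf_ n).
apply: le_trans (Lp_norm_triangle mTn mg) _; apply: leeD => //.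
apply: le_trans (HK _ (tf_ n)) _.
apply: (@le_trans _ _ (k%:E * (1 + Lp_norm p%:E (fun x => (f_ n x - f x)%R)))%E).
  rewrite lee_wpmul2l ?lee_fin// -f1 addeC Lp_normB_sym.
  exact: Lp_norm_triangle.
by rewrite leeDl// mule_ge0 ?lee_fin// Lp_norm_ge0.
Qed.

(** A real function is approximated by the real parts of its approximants, and
    the imaginary parts tend to 0: so real test functions suffice, although the
    approximants in the definition of the extended operator may be complex. *)
Lemma mult_normR_le m (K : \bar R) : bounded_symbol m -> (0 <= K)%E ->
  (forall f, test_fun f -> real_valued f ->
    (Lp_norm p%:E (mult_op m f) <= K * Lp_norm p%:E f)%E) ->
  (mult_normR p m <= K)%E.
Proof.
move=> bm K0 HK; apply: ge_ereal_sup => _ [f [g [rf [[mf _] mg [f_ [tf_ ff gg]]] f1 ->]]].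
case: K K0 HK => [k|_ _|//]; last by rewrite leey.
rewrite lee_fin => k0 HK; apply: le_of_vanishing_errors ff gg => n.
have mfn := test_fun_measurable (tf_ n).
have mTn := measurable_mult_op bm (tf_ n).
apply: le_trans (Lp_norm_triangle mTn mg) _; apply: leeD => //.
have tr := test_fun_Re (tf_ n); have ti := test_fun_Im (tf_ n).
have mr := test_fun_measurable tr; have mi := test_fun_measurable ti.
have -> : mult_op m (f_ n) = fun x => mult_op m (fun t => (ReF (f_ n) t)%:C) x +
    'i * mult_op m (fun t => (ImF (f_ n) t)%:C) x.
  apply/funext => x; rewrite -(mult_opZ 'i x bm ti).
  rewrite -(mult_opD x bm tr (test_funZ 'i ti)).
  congr (mult_op m _ x); apply/funext => t.
  by apply: complex_ext; rewrite ?ReD ?ImD ?ReM ?ImM /ReF /ImF /=; ring.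
have mTr := measurable_mult_op bm tr; have mTi := measurable_mult_op bm ti.
apply: le_trans (Lp_normD p1 mTr (cmeasurableM (cmeasurable_cst 'i) mTi)) _.
apply: leeD.
  apply: le_trans (HK _ tr (fun x => erefl)) _.
  rewrite lee_wpmul2l ?lee_fin// -f1 addeC.
  apply: le_trans (Lp_norm_triangle mf mr) _; apply: leeD => //.
  rewrite Lp_normB_sym; apply: le_Lp_norm => //.
  + exact: cmeasurableD mr (cmeasurableN mf).
  + exact: cmeasurableD mfn (cmeasurableN mf).
  + move=> x; have -> : (ReF (f_ n) x)%:C - f x = (Re (f_ n x - f x))%:C.
      by apply: complex_ext; rewrite ?ReD ?ImD ?ReN ?ImN /= ?rf ?subr0.
    by rewrite modulus_real normr_Re_le.
rewrite (Lp_normZ p1 _ mTi) modulus_i mul1e.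
apply: le_trans (HK _ ti (fun x => erefl)) _; rewrite lee_wpmul2l ?lee_fin//.
apply: le_Lp_norm => //; first exact: cmeasurableD mfn (cmeasurableN mf).
move=> x; have -> : ImF (f_ n) x = Im (f_ n x - f x).
  by rewrite ImD ImN rf subr0.
by rewrite modulus_real normr_Im_le.
Qed.

Lemma fourier_dilate f (e y : R) : 0 < e -> test_fun f ->
  fourier (fun x => f (e * x + 0)) y = (e^-1)%:C * fourier f (e^-1 * y + 0).
Proof.
move=> e0 tf; have e1 := lt0r_neq0 e0.
have ig := cintegrable_fourier_integrand (e^-1 * y + 0) tf.
have := cintegral_affine 0 e1 ig; rewrite (gtr0_norm e0) => h.
rewrite /fourier -h; apply: eq_cintegral => x; congr (expi _ * _).
by field.
Qed.

Lemma cintegrable_mult_op_integrand m f x : bounded_symbol m -> test_fun f ->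
  cintegrable (fun y => expi (2 * pi * x * y) * (m y * fourier f y)).
Proof.
move=> bm tf; apply: cintegrable_expiM; first exact: measurable_scale.
exact: cintegrable_multiplier.
Qed.

(** The Fourier transform turns a dilation into the inverse dilation, so
    multipliers that differ by a dilation are conjugate. *)
Lemma mult_op_dilate m f (e x : R) : 0 < e -> bounded_symbol m -> test_fun f ->
  mult_op m (fun t => f (e * t + 0)) (e^-1 * x + 0) =
  mult_op (fun y => m (e * y + 0)) f x.
Proof.
move=> e0 bm tf; have e1 := lt0r_neq0 e0.
have tfe := test_fun_affine 0 e1 tf.
have ig := cintegrable_mult_op_integrand (e^-1 * x + 0) bm tfe.
have ec : (e * e^-1)%:C = 1 by rewrite divff.
have := cintegral_affine 0 e1 ig; rewrite (gtr0_norm e0) => h.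
rewrite [LHS](_ : _ = e%:C * ((e^-1)%:C * cintegral (fun y => expi (2 * pi * (e^-1 * x + 0) * y) *
    (m y * fourier (fun t => f (e * t + 0)) y)))); last by rewrite mulrA -realCM ec mul1r.
rewrite -h -cintegralZ; last exact: (cintegrable_affine 0 e1 ig).
apply: eq_cintegral => y; rewrite (fourier_dilate _ e0 tf).
rewrite [e%:C * _]mulrCA -[in RHS](mul1r (fourier f y)) -ec realCM.
rewrite (_ : e^-1 * (e * y + 0) + 0 = y); last by field.
rewrite (_ : 2 * pi * (e^-1 * x + 0) * (e * y + 0) = 2 * pi * x * y); last by field.
by congr (_ * _); ring.
Qed.

Lemma bounded_symbol_affine m (a b : R) : bounded_symbol m ->
  bounded_symbol (fun y => m (a * y + b)).
Proof. by move=> [mm [M mM]]; split; [exact: cmeasurable_affine|exists M]. Qed.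

Definition scale_seq (n : nat) : R := n.+1%:R^-1.

Lemma scale_seq_gt0 n : 0 < scale_seq n.
Proof. by rewrite invr_gt0 ltr0n. Qed.

Lemma cvg_scale_seq (y : R) : scale_seq n * y + 0 @[n --> \oo] --> (0 : R).
Proof.
rewrite -[X in _ --> X]addr0 -[X in _ --> X + _](mul0r y).
by apply: cvgD; [apply: cvgM; [exact: cvg_harmonic0|exact: cvg_cst]|exact: cvg_cst].
Qed.

(** Lower semicontinuity of operator bounds under pointwise limits of dilations:
    dominated convergence on the frequency side, Fatou's lemma on the space side.
    The two powers of the scale, from [f] and from its image, cancel. *)
Lemma dilation_limit_bound m m0 f (S : \bar R) : bounded_symbol m -> bounded_symbol m0 ->
  (forall y, ccvg (fun n => m (scale_seq n * y + 0)) (m0 y)) -> (0 <= S)%E ->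
  test_fun f ->
  (forall n, (Lp_norm p%:E (mult_op m (fun x => f (scale_seq n * x + 0)%R)) <=
     S * Lp_norm p%:E (fun x => f (scale_seq n * x + 0)%R))%E) ->
  (Lp_norm p%:E (mult_op m0 f) <= S * Lp_norm p%:E f)%E.
Proof.
move=> bm bm0 mm0 S0 tf HS.
have [mm [M mM]] := bm.
apply: (@Lp_norm_fatou _ _ p1 (fun n => mult_op (fun y => m (scale_seq n * y + 0)) f)).
- by rewrite mule_ge0// Lp_norm_ge0.
- by move=> n; apply: measurable_mult_op => //; exact: bounded_symbol_affine.
- exact: measurable_mult_op.
- move=> x; apply: (@cintegral_dominated _ _ _ (fun y => M * modulus (fourier f y))).
  + move=> n; apply: cintegrable_measurable.
    exact: (cintegrable_mult_op_integrand _ (bounded_symbol_affine _ _ bm)).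
  + by move=> y; apply: ccvgM; [exact: ccvg_cst|apply: ccvgM => //; exact: ccvg_cst].
  + rewrite /comp; under eq_fun do rewrite EFinM.
    apply: integrableZl => //; apply: integrable_modulus.
    have := @cintegrable_multiplier _ (fun=> 1) f _ tf.
    under [X in cintegrable X]eq_fun do rewrite mul1r; apply.
    by split; [exact: cmeasurable_cst|exists 1; rewrite (modulus_real 1) normr1].
  + move=> n y; rewrite !modulusM modulus_expi mul1r ler_wpM2r ?modulus_ge0//.
- move=> n; have e0 := scale_seq_gt0 n; have e1 := lt0r_neq0 e0.
  have := HS n; move: (scale_seq n) e0 e1 => e e0 e1.
  have ei1 : e^-1 != 0 by rewrite invr_eq0.
  have tfe := test_fun_affine 0 e1 tf.
  have -> : mult_op (fun y => m (e * y + 0)) f =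
      fun x => mult_op m (fun t => f (e * t + 0)) (e^-1 * x + 0).
    by apply/funext => x; rewrite (mult_op_dilate x e0 bm tf).
  rewrite (Lp_norm_affine _ 0 ei1 (measurable_mult_op bm tfe)).
  rewrite (Lp_norm_affine _ 0 e1 (test_fun_measurable tf)).
  rewrite (gtr0_norm e0) [`|e^-1|]gtr0_norm ?invr_gt0// invrK => HSn.
  have c0 : 0 < e^-1 `^ p^-1 by rewrite powR_gt0 ?invr_gt0.
  have cc : e `^ p^-1 * e^-1 `^ p^-1 = 1.
    by rewrite -powRM ?invr_ge0 ?ltW// mulfV// powR1.
  apply: le_trans (lee_wpmul2l _ HSn) _; first by rewrite lee_fin powR_ge0.
  by rewrite [(S * _)%E]muleCA muleA -EFinM cc mul1e.
Qed.

End operator_norm_bounds.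

(** * Cutting off the image of a multiplier *)

Section cutoff.
Variable R : realType.
Local Notation C := R[i].
Local Notation Re := complex.Re.
Local Notation Im := complex.Im.
Local Notation mu := (@lebesgue_measure R).
Implicit Types f g m : R -> C.

#[local] Opaque smooth test_fun.

Lemma half_lineE (y : R) : half_line y = if 0 < y then 1 else 0.
Proof.
rewrite /half_line indicE; have [y0|y0] := ltP 0 y.
  by rewrite mem_set//= in_itv /= y0.
by rewrite memNset//= in_itv /= andbT => /lt_geF; rewrite y0.
Qed.

Lemma modulus_half_line_le1 (y : R) : modulus (half_line y) <= 1.
Proof.
by rewrite half_lineE; case: ifP => _; rewrite ?modulus0// (modulus_real 1) normr1.
Qed.

Lemma half_line_bounded_symbol : bounded_symbol (@half_line R).
Proof.
split; last by exists 1; exact: modulus_half_line_le1.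
by apply: cmeasurable_real; apply: measurable_indic.
Qed.

Lemma pos_partE m y : pos_part m y = half_line y * m y.
Proof. by rewrite half_lineE /pos_part; case: ifP; rewrite ?mul1r ?mul0r. Qed.

Lemma pos_part_bounded_symbol m : bounded_symbol m -> bounded_symbol (pos_part m).
Proof.
move=> [mm [M mM]]; have [ms _] := half_line_bounded_symbol.
rewrite (_ : pos_part m = fun y => half_line y * m y); last first.
  by apply/funext => y; rewrite pos_partE.
split; first exact: cmeasurableM.
exists M => y; rewrite modulusM; apply: le_trans (mM y).
by rewrite ler_piMl ?modulus_ge0 ?modulus_half_line_le1.
Qed.

(** The point 0 is a genuine exception: there the sequence is constantly
    [half_line u]. *)
Lemma half_line_cvg (u z : R) : z != 0 ->
  ccvg (fun n => half_line (scale_seq R n * u + z)) (half_line z).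
Proof.
move=> z0.
have h : scale_seq R n * u + z @[n --> \oo] --> z.
  rewrite -[X in _ --> X]add0r; apply: cvgD; last exact: cvg_cst.
  by have := @cvg_scale_seq R u; under eq_fun do rewrite addr0.
have E : \forall n \near \oo, half_line z = half_line (scale_seq R n * u + z).
  have [zn|zp|zE] := ltgtP z 0; last by rewrite zE eqxx in z0.
    near=> n; rewrite !half_lineE !ifN// -leNgt.
      by near: n; move/cvgr_le : h; apply.
    exact: ltW.
  near=> n; rewrite !half_lineE !ifT//.
  by near: n; move/cvgr_gt : h; apply.
by split; apply: cvg_near_cst; apply: filterS E => n <-.
Unshelve. all: by end_near. Qed.

Definition cutoff (n : nat) (t : R) : C := cbump (scale_seq R n * t + 0).

Lemma test_cutoff n : test_fun (cutoff n).
Proof.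
apply: test_fun_affine; last exact: test_cbump.
exact: lt0r_neq0 (scale_seq_gt0 _ n).
Qed.

(** The image [mult_op m f] is smooth but not a test function; multiplied by wide
    cutoffs it becomes one, to which the half-line bound applies. *)
Definition cutoff_mult_op m f n (t : R) : C := mult_op m f t * cutoff n t.

Lemma test_cutoff_mult_op m f n : bounded_symbol m -> test_fun f ->
  test_fun (cutoff_mult_op m f n).
Proof.
by move=> bm tf; apply: test_funM; [exact: csmooth_mult_op|exact: test_cutoff].
Qed.

Lemma modulus_cutoff_mult_op_le m f n t :
  modulus (cutoff_mult_op m f n t) <= modulus (mult_op m f t).
Proof. by rewrite modulusM ler_piMr ?modulus_ge0 ?modulus_cbump_le1. Qed.

Lemma cintegrable_fourier f : test_fun f -> cintegrable (fourier f).
Proof.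
move=> tf; have := @cintegrable_multiplier _ (fun=> 1) f _ tf.
under [X in cintegrable X]eq_fun do rewrite mul1r; apply.
by split; [exact: cmeasurable_cst|exists 1 => y; rewrite (modulus_real 1) normr1].
Qed.

(** Multiplying by a cutoff convolves the spectrum. The image [mult_op m f] is
    itself a Fourier integral, so this is an instance of the multiplication
    formula. *)
Lemma fourier_cutoff_mult_op m f n y : bounded_symbol m -> test_fun f ->
  fourier (cutoff_mult_op m f n) y =
  cintegral (fun z => (m z * fourier f z) * fourier (cutoff n) (1 * y + - z)).
Proof.
move=> bm tf.
have iA : cintegrable (fun t => expi (- (2 * pi * t * y)) * cutoff n t).
  by apply: cintegrable_fourier_integrand; exact: test_cutoff.
have iG := cintegrable_multiplier bm tf.
have := cmultiplication_formula (2 * pi) iA iG.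
rewrite -[X in X = _ -> _]/(cintegral (fun t => _ * mult_op m f t)) => h.
transitivity (cintegral (fun t => expi (- (2 * pi * t * y)) * cutoff n t * mult_op m f t)).
  by apply: eq_cintegral => t; rewrite -[RHS]mulrA [cutoff n t * _]mulrC.
rewrite h; apply: eq_cintegral => z; congr (_ * _); apply: eq_cintegral => t.
by rewrite mulrA -expiD; congr (expi _ * _); ring.
Qed.

Lemma integral_fourier_cutoff n z : \int[mu]_y modulus (fourier (cutoff n) (1 * y + - z)) =
  \int[mu]_y modulus (fourier (cutoff n) y).
Proof.
have h := integrable_modulus (cintegrable_fourier (test_cutoff n)).
have := @Rintegral_affine _ 1 (- z) _ _ h; rewrite normr1 invr1 mul1r; apply.
exact: oner_neq0.
Qed.

Lemma measurable_snd_sub_fst : measurable_fun setT (fun z : R * R => 1 * z.2 + - z.1).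
Proof.
apply: measurable_funD; first by apply: measurable_funM.
by apply: measurableT_comp; first exact: oppr_measurable.
Qed.

(** Exchanging the frequency integrals and rescaling the inner one exhibits the
    half-line multiplier of the cut off function as a multiplier [b], a
    half-line smoothed at scale [scale_seq n]. *)
Lemma half_line_cutoff m f n x : bounded_symbol m -> test_fun f ->
  let b z := cintegral (fun u => expi (2 * pi * x * (scale_seq R n * u + z)) *
       (half_line (scale_seq R n * u + z) * fourier (@cbump R) u)) in
  cintegrable (fun z => m z * fourier f z * b z) /\
  mult_op (@half_line R) (cutoff_mult_op m f n) x =
    cintegral (fun z => m z * fourier f z * b z).
Proof.
move=> bm tf b.
have [ms _] := half_line_bounded_symbol.
have iG := cintegrable_multiplier bm tf.
have mG := cintegrable_measurable iG.
have ic := cintegrable_fourier (test_cutoff n).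
have mc := cintegrable_measurable ic.
pose H z y := expi (2 * pi * x * y) * (half_line y * fourier (cutoff n) (1 * y + - z)).
pose K (w : R * R) := (m w.1 * fourier f w.1) * H w.1 w.2.
have iH z : cintegrable (H z).
  apply: cintegrable_expiM; first exact: measurable_scale.
  apply: (@cintegrableM_bounded _ _ _ 1) => //; first exact: modulus_half_line_le1.
  by apply: cintegrable_affine => //; exact: oner_neq0.
have [mK1 mK2] : cmeasurable2 K.
  apply: cmeasurable2M; first exact: (cmeasurable2_comp mG).
  apply: cmeasurable2M.
    by apply: cmeasurable2_expi; apply: measurable_funM.
  apply: cmeasurable2M; first exact: (cmeasurable2_comp ms).
  by apply: (cmeasurable2_comp mc); exact: measurable_snd_sub_fst.
pose B := \int[mu]_y modulus (fourier (cutoff n) y).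
pose a z := modulus (m z * fourier f z) * B.
have ia : mu.-integrable setT (EFin \o a).
  rewrite /a /comp; under eq_fun do rewrite EFinM; apply: integrableZr => //.
  exact: integrable_modulus.
have Ka z : (\int[mu]_y (modulus (K (z, y)))%:E <= (a z)%:E)%E.
  rewrite /a /B -(integral_fourier_cutoff n z) EFinM.
  have i1 : mu.-integrable setT (fun y => (modulus (fourier (cutoff n) (1 * y + - z)))%:E).
    by apply: integrable_modulus; apply: cintegrable_affine => //; exact: oner_neq0.
  rewrite /Rintegral fineK; last exact: integrable_fin_num i1.
  rewrite -ge0_integralZl//; last 3 first.
  + exact: measurable_int i1.
  + by move=> y _; rewrite lee_fin modulus_ge0.
  + by rewrite lee_fin modulus_ge0.
  apply: ge0_le_integral => //.
  + by move=> y _; rewrite lee_fin modulus_ge0.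
  + apply/measurable_EFinP; apply: cmeasurable_modulus.
    apply: (@cmeasurableM _ (fun=> m z * fourier f z) (H z)).
      exact: cmeasurable_cst.
    exact: cintegrable_measurable (iH z).
  + by apply: measurable_funeM; exact: measurable_int i1.
  + move=> y _; rewrite -EFinM lee_fin /K /H !modulusM modulus_expi mul1r.
    rewrite ler_wpM2l ?mulr_ge0 ?modulus_ge0//.
    by rewrite ler_piMl ?modulus_ge0 ?modulus_half_line_le1.
have [iK EK] := cfubini mK1 mK2 ia Ka.
have e0 := scale_seq_gt0 R n; have e1 := lt0r_neq0 e0.
(* The substitution [y = e * u + z] undoes the dilation of the bump. *)
have KE : (fun z => cintegral (fun y => K (z, y))) = (fun z => m z * fourier f z * b z).
  apply/funext => z; rewrite /K /= cintegralZ; last exact: iH.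
  apply: (congr1 (fun w => m z * fourier f z * w)); rewrite /b.
  have := cintegral_affine z e1 (iH z); rewrite (gtr0_norm e0) => h.
  rewrite -[LHS]mul1r (_ : 1 = (scale_seq R n)%:C * ((scale_seq R n)^-1)%:C); last first.
    by rewrite -realCM divff.
  rewrite -mulrA -h -cintegralZ; last exact: cintegrable_affine.
  apply: eq_cintegral => u; rewrite /H mulrCA; congr (_ * _).
  rewrite mulrCA; congr (_ * _).
  rewrite (fourier_dilate _ e0 (@test_cbump R)) mulrA -realCM (divff e1) mul1r.
  rewrite (_ : _ * _ + 0 = u); last by field.
  exact: mul1r.
split; first by rewrite -KE.
rewrite -KE EK; apply: eq_cintegral => y.
rewrite (fourier_cutoff_mult_op n y bm tf) mulrA -cintegralZ; last first.
  under eq_fun do rewrite mulrC.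
  apply: (@cintegrableM_bounded _ (fun z => fourier (cutoff n) (1 * y + - z)) _
    (\int[mu]_t modulus (cutoff n t)) _ _ iG).
    have E z : 1 * y + - z = (-1) * z + y by ring.
    by under eq_fun do rewrite E; exact: cmeasurable_affine.
  by move=> z; apply: fourier_le; exact: test_cutoff.
by apply: eq_cintegral => z; rewrite /K /H /=; ring.
Qed.

(** The smoothed half-lines of [half_line_cutoff] converge away from 0 to the
    half-line itself, because the transform of the bump has integral 1. *)
Lemma cvg_half_line_cutoff m f x : bounded_symbol m -> test_fun f ->
  ccvg (fun n => mult_op (@half_line R) (cutoff_mult_op m f n) x)
       (mult_op (pos_part m) f x).
Proof.
move=> bm tf.
have [ms _] := half_line_bounded_symbol.
have iG := cintegrable_multiplier bm tf.
have ib := cintegrable_fourier (@test_cbump R).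
pose b n z := cintegral (fun u => expi (2 * pi * x * (scale_seq R n * u + z)) *
       (half_line (scale_seq R n * u + z) * fourier (@cbump R) u)).
have -> : (fun n => mult_op (@half_line R) (cutoff_mult_op m f n) x) =
    (fun n => cintegral (fun z => m z * fourier f z * b n z)).
  by apply/funext => n; have [_ ->] := half_line_cutoff n x bm tf.
have -> : mult_op (pos_part m) f x =
    cintegral (fun z => (m z * fourier f z) * (expi (2 * pi * x * z) * half_line z)).
  by apply: eq_cintegral => z; rewrite pos_partE; ring.
pose B := \int[mu]_u modulus (fourier (@cbump R) u).
have ih n z : cintegrable (fun u => expi (2 * pi * x * (scale_seq R n * u + z)) *
       (half_line (scale_seq R n * u + z) * fourier (@cbump R) u)).
  apply: cintegrable_expiM.
    by apply: measurable_funM => //; exact: measurable_affine.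
  apply: (@cintegrableM_bounded _ _ _ 1) => //.
    exact: cmeasurable_affine.
  by move=> u; exact: modulus_half_line_le1.
have hB n z u : modulus (expi (2 * pi * x * (scale_seq R n * u + z)) *
    (half_line (scale_seq R n * u + z) * fourier (@cbump R) u)) <=
    modulus (fourier (@cbump R) u).
  rewrite !modulusM modulus_expi mul1r.
  by rewrite ler_piMl ?modulus_ge0 ?modulus_half_line_le1.
apply: (@cintegral_dominated_ae _ _ _ (fun z => modulus (m z * fourier f z) * B)).
- move=> n; apply: cintegrable_measurable.
  by have [h _] := half_line_cutoff n x bm tf.
- apply: cmeasurableM; first exact: cintegrable_measurable.
  by apply: cmeasurableM ms; apply: cmeasurable_expi; exact: measurable_scale.
- have z0 : {ae mu, forall z, z != 0}.
    exists [set 0]; split => //; first exact: lebesgue_measure_set1.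
    by move=> z /= /negP; rewrite negbK => /eqP.
  apply: ae_mono z0 => z z0; apply: ccvgM; first exact: ccvg_cst.
  have -> : expi (2 * pi * x * z) * half_line z = cintegral (fun u =>
      expi (2 * pi * x * z) * (half_line z * fourier (@cbump R) u)).
    under eq_cintegral do rewrite mulrA.
    by rewrite cintegralZ// fourier_inversion0 ?cbump0 ?mulr1//; exact: test_cbump.
  apply: (@cintegral_dominated _ _ _ (fun u => modulus (fourier (@cbump R) u))).
  + by move=> n; exact: cintegrable_measurable (ih n z).
  + move=> u; apply: ccvgM.
      apply: ccvg_expi; apply: cvgM; first exact: cvg_cst.
      rewrite -[X in _ --> X]add0r; apply: cvgD; last exact: cvg_cst.
      by have := @cvg_scale_seq R u; under eq_fun do rewrite addr0.
    apply: ccvgM; last exact: ccvg_cst.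
    exact: half_line_cvg.
  + exact: integrable_modulus.
  + by move=> n u; exact: hB.
- rewrite /comp; under eq_fun do rewrite EFinM; apply: integrableZr => //.
  exact: integrable_modulus.
- move=> n z; rewrite modulusM ler_wpM2l ?modulus_ge0//.
  apply: le_trans (le_modulus_cintegral (ih n z)) _.
  apply: le_Rintegral => //; first exact: integrable_modulus (ih n z).
  exact: integrable_modulus.
Qed.

End cutoff.

(** * Multipliers with nonnegative transform *)

Section nonnegative_transform.
Variable R : realType.
Local Notation C := R[i].
Local Notation Re := complex.Re.
Local Notation Im := complex.Im.
Local Notation mu := (@lebesgue_measure R).
Implicit Types f g h m : R -> C.

#[local] Opaque smooth test_fun.

Lemma rapidly_decreasing_compact (u : R -> R) (M : R) : smooth u ->
  (forall x, M < `|x| -> u x = 0) -> rapidly_decreasing u.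
Proof.
move=> su uM k n.
have [sn nM] : smooth (derive1n n u) /\ forall x, M < `|x| -> derive1n n u x = 0.
  elim: n => [|n [s1 s2]]; first by split; [exact: su|exact: uM].
  rewrite /derive1n iterS -/(derive1n n u); split; first exact: smooth_derive.
  exact: derive1_out.
have sk : smooth (fun x : R => x ^+ k * derive1n n u x).
  by apply: (@smoothM _ (fun x => x ^+ k)); [exact: smooth_pow|exact: sn].
apply: (@compact_support_bounded _ _ M); first exact: (smooth_continuous sk).
by move=> x /nM ->; rewrite mulr0.
Qed.

Lemma test_fun_schwartz f : test_fun f -> schwartz f.
Proof.
move=> /test_funP[[s1 s2] [M fM]]; split; [exact: s1|exact: s2| |].
  by apply: (rapidly_decreasing_compact s1 (M := M)) => x /fM; rewrite /ReF => ->.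
by apply: (rapidly_decreasing_compact s2 (M := M)) => x /fM; rewrite /ImF => ->.
Qed.

Lemma Lp1_integrable h : Lp 1%:E h -> cintegrable h.
Proof.
move=> [mh]; rewrite /Lp_norm Lnorm1 => hoo.
apply: (@le_cintegrable _ _ (fun x => modulus (h x))) => //.
apply/integrableP; split => //.
by apply/measurable_EFinP; exact: cmeasurable_modulus.
Qed.

Lemma fourier_translate f x y : test_fun f ->
  fourier (fun t => f (1 * t + x)) y = expi (2 * pi * x * y) * fourier f y.
Proof.
move=> tf; have ig := cintegrable_fourier_integrand y tf.
have := cintegral_affine x (oner_neq0 R) ig; rewrite normr1 invr1 mul1r => h.
rewrite /fourier -h -cintegralZ; last exact: (cintegrable_affine x (oner_neq0 R) ig).
apply: eq_cintegral => t; rewrite mulrA -expiD; congr (expi _ * _).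
ring.
Qed.

Definition transform_on_tests m h := forall phi, test_fun phi ->
  cintegral (fun y => m y * fourier phi y) = cintegral (fun y => h y * phi y).

(** The frequency factor [expi (2 pi x y)] is absorbed into the test function as a
    translation, and the transform identity applies to the translate. *)
Lemma mult_op_convolution m h f x : transform_on_tests m h -> test_fun f ->
  mult_op m f x = cintegral (fun t => h t * f (1 * t + x)).
Proof.
move=> mh tf; rewrite -mh; last exact: test_fun_affine (oner_neq0 R) tf.
by apply: eq_cintegral => y; rewrite fourier_translate// mulrCA.
Qed.

Variable p : R.
Hypothesis p1 : 1 < p.
Let p0 : 0 < p. Proof. exact: lt_trans p1. Qed.

(** Hoelder's inequality for the measure with density [w]. *)
Lemma weighted_power_le (w v : R -> R) : measurable_fun setT w ->
  measurable_fun setT v -> (forall t, 0 <= w t) -> (forall t, 0 <= v t) ->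
  ((\int[mu]_t (w t * v t)%:E) `^ p <=
   (\int[mu]_t (w t)%:E) `^ (p - 1) * \int[mu]_t (w t * v t `^ p)%:E)%E.
Proof.
move=> mw mv w0 v0.
(* The conjugate exponent: [w * v] is [w ^ (1 / p) * v] times [w ^ (1 / q)]. *)
pose q := p / (p - 1).
have pm0 : 0 < p - 1 by rewrite subr_gt0.
have q0 : 0 < q by rewrite divr_gt0.
have pq : p^-1 + q^-1 = 1 by rewrite /q; field; rewrite !gt_eqF.
have mpw (r : R) (u : R -> R) : measurable_fun setT u ->
    measurable_fun setT (fun t => u t `^ r).
  by move=> mu'; apply: (measurableT_comp (f := fun x => x `^ r)) => //; exact: measurable_powR.
have H := @hoelder _ _ _ mu (fun t => w t `^ p^-1 * v t) (fun t => w t `^ q^-1) p q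
  (measurable_funM (mpw _ _ mw) mv) (mpw _ _ mw) p0 q0 pq.
have E1 : Lnorm mu 1 (EFin \o ((fun t => w t `^ p^-1 * v t) \* (fun t => w t `^ q^-1)))
    = (\int[mu]_t (w t * v t)%:E)%E.
  rewrite Lnorm1; apply: eq_integral => t _ /=.
  rewrite ger0_norm ?mulr_ge0 ?powR_ge0//; congr EFin.
  rewrite mulrAC -powRD ?pq ?powRr1//; first by rewrite oner_eq0.
have E2 : (Lnorm mu p%:E (EFin \o (fun t => (w t `^ p^-1 * v t)%R)) `^ p =
    \int[mu]_t (w t * v t `^ p)%:E)%E.
  rewrite poweR_Lnorm ?gt_eqF//; apply: eq_integral => t _ /=.
  rewrite ger0_norm ?mulr_ge0 ?powR_ge0// powRM ?powR_ge0//.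
  by rewrite -powRrM mulVf ?gt_eqF// powRr1.
have E3 : (Lnorm mu q%:E (EFin \o (fun t => (w t `^ q^-1)%R)) `^ p =
    (\int[mu]_t (w t)%:E) `^ (p - 1))%E.
  have pE : q * (p - 1) = p by rewrite /q; field; rewrite gt_eqF.
  rewrite -[X in (_ `^ X)%E = _]pE poweRrM poweR_Lnorm ?gt_eqF//.
  apply: (congr1 (fun z => z `^ (p - 1))%E); apply: eq_integral => t _ /=.
  by rewrite ger0_norm ?powR_ge0// -powRrM mulVf ?gt_eqF// powRr1.
rewrite E1 in H.
rewrite -E2 -E3 muleC -poweRM ?Lnorm_ge0//.
apply: gt0_ler_poweR H; rewrite ?ltW//.
  rewrite in_itv /= leey andbT; apply: integral_ge0 => t _.
  by rewrite lee_fin mulr_ge0.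
by rewrite in_itv /= leey andbT mule_ge0// Lnorm_ge0.
Qed.

(** Young's inequality for the convolution of an integrable function with a test
    function: the pointwise Hoelder bound is integrated in [x] by Tonelli's
    theorem and translation invariance. *)
Lemma convolution_Lp h f : cintegrable h -> test_fun f ->
  cmeasurable (fun x => cintegral (fun t => h t * f (1 * t + x))) ->
  (Lp_norm p%:E (fun x => cintegral (fun t => (h t * f (1 * t + x))%R)) <=
   (\int[mu]_t modulus (h t))%:E * Lp_norm p%:E f)%E.
Proof.
move=> ih tf mT; have mh := cintegrable_measurable ih; have mf := test_fun_measurable tf.
have [K fK] := test_fun_bounded tf.
have n1 := oner_neq0 R.
pose a := \int[mu]_t modulus (h t).
have a0 : 0 <= a by apply: Rintegral_ge0 => t _; exact: modulus_ge0.
have aE : (\int[mu]_t (modulus (h t))%:E)%E = a%:E.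
  by rewrite /a /Rintegral fineK//; apply: integrable_fin_num => //; exact: integrable_modulus.
have mft x : cmeasurable (fun t => f (1 * t + x)) by exact: cmeasurable_affine.
have ihf x : cintegrable (fun t => h t * f (1 * t + x)).
  under eq_fun do rewrite mulrC.
  by apply: (@cintegrableM_bounded _ _ _ K) => // t; exact: fK.
pose W (z : R * R) := (modulus (h z.2) * modulus (f (1 * z.2 + z.1)) `^ p)%:E.
have mW : measurable_fun setT W.
  apply/measurable_EFinP; apply: measurable_funM.
    exact: (measurableT_comp (cmeasurable_modulus mh)).
  apply: (measurableT_comp (f := fun x => x `^ p)); first exact: measurable_powR.
  apply: (measurableT_comp (cmeasurable_modulus mf)).
  by apply: measurable_funD => //; apply: measurable_funM.
have W0 z : (0 <= W z)%E by rewrite lee_fin mulr_ge0 ?modulus_ge0 ?powR_ge0.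
have pointwise x : ((modulus (cintegral (fun t => (h t * f (1 * t + x))%R)) `^ p)%:E <=
    (a `^ (p - 1))%:E * \int[mu]_t W (x, t))%E.
  have ihx := integrable_modulus (ihf x).
  have := @weighted_power_le (fun t => modulus (h t)) (fun t => modulus (f (1 * t + x)))
    (cmeasurable_modulus mh) (cmeasurable_modulus (mft x))
    (fun t => modulus_ge0 _) (fun t => modulus_ge0 _).
  rewrite aE poweR_EFin; apply: le_trans.
  rewrite -poweR_EFin; apply: gt0_ler_poweR; first exact: ltW.
  - by rewrite in_itv /= leey andbT lee_fin modulus_ge0.
  - rewrite in_itv /= leey andbT; apply: integral_ge0 => t _.
    by rewrite lee_fin mulr_ge0 ?modulus_ge0.
  - have := le_modulus_cintegral (ihf x).
    rewrite -lee_fin /Rintegral fineK; last exact: integrable_fin_num ihx.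
    by under eq_integral do rewrite modulusM.
apply/(Lp_norm_leP p1); first by rewrite mule_ge0 ?lee_fin ?Lp_norm_ge0.
rewrite poweRM ?lee_fin ?Lp_norm_ge0// (Lp_norm_power p1) poweR_EFin.
have mI : measurable_fun setT (fun x => \int[mu]_t W (x, t))%E.
  exact: (measurable_fun_fubini_tonelli_F (m2 := mu) W).
apply: (@le_trans _ _ (\int[mu]_x ((a `^ (p - 1))%:E * \int[mu]_t W (x, t)))%E).
  apply: ge0_le_integral => //.
  - by move=> x _; rewrite lee_fin powR_ge0.
  - exact: measurable_power.
  - exact: measurable_funeM.
rewrite ge0_integralZl//; last 2 first.
- by move=> x _; apply: integral_ge0.
- by rewrite lee_fin powR_ge0.
rewrite (@fubini_tonelli _ _ _ _ _ mu mu W)//.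
rewrite (_ : (\int[mu]_y \int[mu]_x W (x, y) = a%:E * power_integral p f)%E).
  rewrite muleA -EFinM; apply: lee_wpmul2r; first exact: power_integral_ge0.
  by rewrite lee_fin [_ * a]mulrC mulr_powRB1.
transitivity (\int[mu]_y ((modulus (h y))%:E * power_integral p f))%E.
  apply: eq_integral => y _.
  rewrite /W /=; under eq_integral do rewrite EFinM.
  have E := ge0_integral_affine y n1 (measurable_power p mf).
  rewrite ge0_integralZl; first last.
  - by rewrite lee_fin modulus_ge0.
  - by move=> x _; rewrite lee_fin powR_ge0.
  - have S x : 1 * y + x = 1 * x + y by rewrite !mul1r addrC.
    by under eq_fun do rewrite S; apply: measurable_power; exact: cmeasurable_affine.
  - by [].
  apply: (congr1 (fun z => (modulus (h y))%:E * z)%E).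
  rewrite /power_integral E; last by move=> t; rewrite lee_fin powR_ge0.
  rewrite normr1 mul1e.
  by apply: eq_integral => x _; rewrite !mul1r addrC.
rewrite ge0_integralZr ?aE//.
- by apply/measurable_EFinP; exact: cmeasurable_modulus.
- by move=> x _; rewrite lee_fin modulus_ge0.
- exact: power_integral_ge0.
Qed.

(** Testing the transform identity on wider and wider cutoffs evaluates the
    symbol at the origin. *)
Lemma symbol_at_origin m h : bounded_symbol m ->
  (forall y, ccvg (fun n => m (scale_seq R n * y + 0)) (m 0)) ->
  cintegrable h -> transform_on_tests m h -> m 0 = cintegral h.
Proof.
move=> bm m0 ih mh; have [mm [M mM]] := bm; have mh' := cintegrable_measurable ih.
have ib := cintegrable_fourier (@test_cbump R).
pose A n := cintegral (fun y => h y * cutoff n y).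
have A1 : ccvg A (cintegral h).
  apply: (@cintegral_dominated _ _ _ (fun y => modulus (h y))).
  - by move=> n; apply: (cmeasurableM mh'); exact: (test_fun_measurable (@test_cutoff R n)).
  - move=> y; rewrite -[X in ccvg _ X]mulr1 -(cbump0 R); apply: ccvgM.
      exact: ccvg_cst.
    have /test_funP[[s1 s2] _] := @test_cbump R.
    by split; [exact: (cvg_comp _ _ (@cvg_scale_seq R y) (smooth_continuous s1 (x := 0)))|
      exact: (cvg_comp _ _ (@cvg_scale_seq R y) (smooth_continuous s2 (x := 0)))].
  - exact: integrable_modulus.
  - by move=> n y; rewrite modulusM ler_piMr ?modulus_ge0 ?modulus_cbump_le1.
have AE n : A n = cintegral (fun u => m (scale_seq R n * u + 0) * fourier (@cbump R) u).
  rewrite /A -(mh _ (@test_cutoff R n)).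
  have e0 := scale_seq_gt0 R n; have e1 := lt0r_neq0 e0.
  have ig := cintegrable_multiplier bm (@test_cutoff R n).
  have := cintegral_affine 0 e1 ig; rewrite (gtr0_norm e0) => E.
  rewrite -[LHS]mul1r (_ : 1 = (scale_seq R n)%:C * ((scale_seq R n)^-1)%:C); last first.
    by rewrite -realCM divff.
  rewrite -mulrA -E -cintegralZ; last exact: (cintegrable_affine 0 e1 ig).
  apply: eq_cintegral => u; rewrite mulrCA; congr (_ * _).
  rewrite (fourier_dilate _ e0 (@test_cbump R)) mulrA -realCM (divff e1).
  rewrite (_ : _ * _ + 0 = u); last by field.
  exact: mul1r.
have A2 : ccvg A (cintegral (fun u => m 0 * fourier (@cbump R) u)).
  rewrite (_ : A = fun n => cintegral (fun u =>
      m (scale_seq R n * u + 0) * fourier (@cbump R) u)); last by apply/funext.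
  apply: (@cintegral_dominated _ _ _ (fun u => M * modulus (fourier (@cbump R) u))).
  - move=> n; apply: cmeasurableM; first exact: cmeasurable_affine.
    exact: cintegrable_measurable.
  - by move=> u; apply: ccvgM; [exact: m0|exact: ccvg_cst].
  - rewrite /comp; under eq_fun do rewrite EFinM.
    by apply: integrableZl => //; exact: integrable_modulus.
  - by move=> n u; rewrite modulusM ler_wpM2r ?modulus_ge0.
rewrite (ccvg_unique A1 A2) cintegralZ; last exact: ib.
by rewrite (fourier_inversion0 (@test_cbump R)) cbump0 mulr1.
Qed.

(** A multiplier with nonnegative integrable transform [h] is convolution with
    a positive kernel, whose mass is [m 0]. *)
Lemma nonnegative_transform_bound m h f : bounded_symbol m ->
  (forall y, ccvg (fun n => m (scale_seq R n * y + 0)) (m 0)) ->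
  cintegrable h -> {ae mu, forall x, 0 <= h x} -> transform_on_tests m h ->
  test_fun f ->
  (Lp_norm p%:E (mult_op m f) <= (modulus (m 0))%:E * Lp_norm p%:E f)%E.
Proof.
move=> bm m0 ih h0 mh tf.
have TE : mult_op m f = fun x => cintegral (fun t => h t * f (1 * t + x)).
  by apply/funext => x; exact: mult_op_convolution.
have mT := measurable_mult_op bm tf.
have := convolution_Lp ih tf; rewrite -TE => /(_ mT); move=> H.
apply: le_trans H _; apply: lee_wpmul2r; first exact: Lp_norm_ge0.
rewrite lee_fin (symbol_at_origin bm m0 ih mh).
have -> : \int[mu]_t modulus (h t) = \int[mu]_t ReF h t.
  have [i1 i2] := ih.
  rewrite /Rintegral; congr fine; apply: ae_eq_integral => //.
  - by apply/measurable_EFinP; apply: cmeasurable_modulus; exact: cintegrable_measurable.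
  - exact: measurable_int i1.
  - apply: ae_mono h0 => x; rewrite lecE /= => /andP[/eqP hi hr] _.
    by rewrite modulusE hi expr0n addr0 sqrtr_sqr ger0_norm.
exact: (le_trans (ler_norm _) (normr_Re_le (cintegral h))).
Qed.

End nonnegative_transform.

Section real_valued_images.
Variable R : realType.
Local Notation C := R[i].
Local Notation Re := complex.Re.
Local Notation Im := complex.Im.
Local Notation mu := (@lebesgue_measure R).
Implicit Types f m : R -> C.

#[local] Opaque smooth test_fun.

Lemma Rintegral_reflect (u v : R -> R) : mu.-integrable setT (EFin \o u) ->
  (forall x, v x = u (- x)) -> \int[mu]_x v x = \int[mu]_x u x.
Proof.
move=> iu vu; have n1 : (- 1 : R) != 0 by rewrite oppr_eq0 oner_eq0.
have := Rintegral_affine 0 n1 iu; rewrite normrN normr1 invr1 mul1r => <-.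
by apply: eq_Rintegral => x _; rewrite vu addr0 mulN1r.
Qed.

Lemma fourier_real f y : test_fun f -> real_valued f ->
  Re (fourier f (- y)) = Re (fourier f y) /\ Im (fourier f (- y)) = - Im (fourier f y).
Proof.
move=> tf rf; split.
  apply: eq_Rintegral => x _; rewrite /ReF !ReM rf !mulr0 !subr0 /=.
  by rewrite mulrN opprK cosN.
have [_ i2] := cintegrable_fourier_integrand y tf.
rewrite /fourier /cintegral /= -[RHS]mulN1r -RintegralZl//.
apply: eq_Rintegral => x _; rewrite /ImF !ImM rf !mulr0 !add0r /=.
by rewrite mulrN opprK sinN mulrA mulN1r opprK.
Qed.

(** Against an even real symbol the frequency integrand is Hermitian, so its
    imaginary part is odd. *)
Lemma real_valued_mult_op m f : bounded_symbol m -> real_valued m -> even_fun m ->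
  test_fun f -> real_valued f -> real_valued (mult_op m f).
Proof.
move=> bm rm em tf rf x; rewrite /mult_op /cintegral /=.
pose g y := expi (2 * pi * x * y) * (m y * fourier f y).
have [_ ig] := cintegrable_mult_op_integrand x bm tf.
have odd y : ImF g (- y) = - ImF g y.
  have [h1 h2] := fourier_real y tf rf.
  by rewrite /ImF /g em !(ImM, ReM) !rm h1 h2 mulrN /= cosN sinN; ring.
have := Rintegral_reflect (v := fun y => - 1 * ImF g y) ig.
rewrite RintegralZl// => H.
suff : - 1 * \int[mu]_y ImF g y = \int[mu]_y ImF g y by rewrite /g; lra.
by apply: H => y; rewrite mulN1r -odd.
Qed.

End real_valued_images.

(** * Transference between a symbol and the half-line *)

Section transference.
Variable R : realType.
Local Notation C := R[i].
Variable p : R.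
Hypothesis p1 : 1 < p.
Implicit Types f m h : R -> C.

#[local] Opaque smooth test_fun.

(** Continuity at 0 enters through dilations, which flatten the symbol to the
    constant [m 0]. *)
Definition continuous_along_scales m :=
  forall y : R, ccvg (fun n => m (scale_seq R n * y + 0)) (m 0).

Lemma pos_part_scales m y : continuous_along_scales m ->
  ccvg (fun n => pos_part m (scale_seq R n * y + 0)) (m 0 * half_line y).
Proof.
move=> m0; rewrite mulrC.
under [X in ccvg X _]eq_fun => n.
  rewrite pos_partE (_ : half_line (scale_seq R n * y + 0) = half_line y); last first.
    by rewrite !half_lineE addr0 pmulr_rgt0 ?scale_seq_gt0.
  over.
by apply: ccvgM; [exact: ccvg_cst|exact: m0].
Qed.

Lemma test_fun_dilate f n : test_fun f ->
  test_fun (fun x => f (scale_seq R n * x + 0)).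
Proof. by apply: test_fun_affine; exact: lt0r_neq0 (scale_seq_gt0 R n). Qed.

(** Dilating [pos_part m] towards the origin turns it into [m 0 * half_line]. *)
Lemma half_line_scaled_bound m f (S : \bar R) : bounded_symbol m ->
  continuous_along_scales m -> (0 <= S)%E -> test_fun f ->
  (forall n, (Lp_norm p%:E (mult_op (pos_part m) (fun x => f (scale_seq R n * x + 0)%R)) <=
     S * Lp_norm p%:E (fun x => f (scale_seq R n * x + 0)%R))%E) ->
  ((modulus (m 0))%:E * Lp_norm p%:E (mult_op (@half_line R) f) <=
   S * Lp_norm p%:E f)%E.
Proof.
move=> bm m0 S0 tf HS.
have bs := half_line_bounded_symbol R; have bp := pos_part_bounded_symbol bm.
have bl : bounded_symbol (fun y => m 0 * half_line y).
  have [ms _] := bs; split; first by apply: cmeasurableM => //; exact: cmeasurable_cst.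
  exists (modulus (m 0)) => y; rewrite modulusM ler_piMr ?modulus_ge0//.
  exact: modulus_half_line_le1.
have := dilation_limit_bound p1 bp bl (fun y => pos_part_scales y m0) S0 tf HS.
rewrite -(Lp_normZ p1 _ (measurable_mult_op bs tf)).
congr (_ <= _)%E; congr (Lp_norm _); apply/funext => x.
rewrite /mult_op -cintegralZ; last exact: cintegrable_mult_op_integrand.
by apply: eq_cintegral => y; ring.
Qed.

Lemma lee_scale_down (L : R) (x S : \bar R) : 0 < L -> (0 <= S)%E ->
  ((x <= (L^-1)%:E * S)%E -> (x * L%:E <= S)%E).
Proof. by move=> L0 S0; rewrite lee_pdivlMl// muleC. Qed.

Lemma scaled_norm_bound (L : R) (S N x : \bar R) : 0 < L ->
  (L%:E * x <= S * N)%E -> (x <= (L^-1)%:E * S * N)%E.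
Proof. by move=> L0; rewrite -muleA lee_pdivlMl. Qed.

Section symbol.
Variable m : R -> C.
Hypothesis bm : bounded_symbol m.
Hypothesis m0 : continuous_along_scales m.
Hypothesis mn0 : m 0 != 0.

Let bs := half_line_bounded_symbol R.
Let bp := pos_part_bounded_symbol bm.

Let L0 : 0 < modulus (m 0).
Proof.
rewrite lt0r modulus_ge0 andbT; apply/negP => /eqP /modulus0_eq0 h.
by move: mn0; rewrite h eqxx.
Qed.

Lemma lower_bound : (c_ p * (modulus (m 0))%:E <= mult_norm p (pos_part m))%E.
Proof.
have S0 := mult_norm_ge0 p1 bp.
apply: lee_scale_down => //; apply: (mult_norm_le p1 bs).
  by rewrite mule_ge0// lee_fin invr_ge0 ltW.
move=> f tf; apply: scaled_norm_bound => //.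
apply: half_line_scaled_bound => // n.
by apply: (mult_norm_ge p1 bp); exact: test_fun_dilate.
Qed.

Lemma lower_boundR : (cR_ p * (modulus (m 0))%:E <= mult_normR p (pos_part m))%E.
Proof.
have S0 := mult_normR_ge0 p1 bp.
apply: lee_scale_down => //; apply: (mult_normR_le p1 bs).
  by rewrite mule_ge0// lee_fin invr_ge0 ltW.
move=> f tf rf; apply: scaled_norm_bound => //.
apply: half_line_scaled_bound => // n.
apply: (mult_normR_ge p1 bp); first exact: test_fun_dilate.
by move=> x; exact: rf.
Qed.

(** As [pos_part m] is the composite of [m] and the half-line multiplier, the
    bounds multiply; the cutoffs make the composite meaningful on test functions
    and do not increase the norm of the intermediate function. *)
Lemma pos_part_bound f (S : \bar R) : (0 <= S)%E -> test_fun f ->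
  (forall n, (Lp_norm p%:E (mult_op (@half_line R) (cutoff_mult_op m f n)) <=
     S * Lp_norm p%:E (cutoff_mult_op m f n))%E) ->
  (Lp_norm p%:E (mult_op (pos_part m) f) <= S * mult_norm p m * Lp_norm p%:E f)%E.
Proof.
move=> S0 tf HS; have N0 := mult_norm_ge0 p1 bm.
apply: (@Lp_norm_fatou _ _ p1 (fun n => mult_op (@half_line R) (cutoff_mult_op m f n))).
- by rewrite mule_ge0 ?mule_ge0 ?Lp_norm_ge0.
- by move=> n; apply: (measurable_mult_op bs); exact: (test_cutoff_mult_op n bm tf).
- exact: measurable_mult_op bp tf.
- by move=> x; exact: cvg_half_line_cutoff.
- move=> n; apply: le_trans (HS n) _; rewrite -muleA; apply: lee_wpmul2l => //.
  apply: le_trans (mult_norm_ge p1 bm tf).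
  apply: (le_Lp_norm p1).
  + exact: test_fun_measurable (test_cutoff_mult_op n bm tf).
  + exact: measurable_mult_op.
  + by move=> t; exact: modulus_cutoff_mult_op_le.
Qed.

Lemma upper_bound : (mult_norm p (pos_part m) <= c_ p * mult_norm p m)%E.
Proof.
have S0 := mult_norm_ge0 p1 bs.
apply: (mult_norm_le p1 bp); first by apply: mule_ge0; [exact: S0|exact: (mult_norm_ge0 p1 bm)].
move=> f tf; apply: (pos_part_bound S0 tf) => n.
exact: (mult_norm_ge p1 bs (test_cutoff_mult_op n bm tf)).
Qed.

Lemma upper_boundR : real_valued m -> even_fun m ->
  (mult_normR p (pos_part m) <= cR_ p * mult_norm p m)%E.
Proof.
move=> rm em; have S0 := mult_normR_ge0 p1 bs.
apply: (mult_normR_le p1 bp); first by apply: mule_ge0; [exact: S0|exact: (mult_norm_ge0 p1 bm)].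
move=> f tf rf; apply: (pos_part_bound S0 tf) => n.
apply: (mult_normR_ge p1 bs (test_cutoff_mult_op n bm tf)) => t.
by rewrite ImM (real_valued_mult_op bm rm em tf rf) mul0r addr0 mulr0.
Qed.

Lemma nonnegative_transform_norm h : Lp 1%:E h ->
  {ae @lebesgue_measure R, forall x, 0 <= h x} -> transform_on_tests m h ->
  (mult_norm p m <= (modulus (m 0))%:E)%E.
Proof.
move=> /Lp1_integrable ih h0 mh.
apply: (mult_norm_le p1 bm); first by rewrite lee_fin modulus_ge0.
by move=> f tf; exact: (nonnegative_transform_bound p1 bm m0 ih h0 mh tf).
Qed.

End symbol.
End transference.

Section truncation.
Variable R : realType.
Local Notation C := R[i].
Local Notation mu := (@lebesgue_measure R).
Implicit Types f m : R -> C.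

#[local] Opaque smooth test_fun.

(** An essentially bounded symbol is changed on a null set into a bounded one. A
    threshold above the modulus at 0 keeps continuity at 0. *)
Definition truncate (M : R) m (y : R) : C := if modulus (m y) <= M then m y else 0.

Lemma cmeasurable_truncate M m : cmeasurable m -> cmeasurable (truncate M m).
Proof.
move=> mm.
have mA : measurable [set y : R | modulus (m y) <= M].
  have := cmeasurable_modulus mm measurableT (measurable_itv `]-oo, M]).
  by rewrite setTI; congr measurable; apply/seteqP; split => y /=; rewrite in_itv.
have -> : truncate M m = fun y => (\1_[set y | modulus (m y) <= M] y)%:C * m y.
  apply/funext => y; rewrite /truncate indicE; case: ifPn => h.
    by rewrite mem_set// mul1r.
  by rewrite memNset ?mul0r//; exact/negP.
by apply: cmeasurableM => //; apply: cmeasurable_real; exact: measurable_indic.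
Qed.

Lemma truncate_bounded_symbol M m : 0 <= M -> cmeasurable m ->
  bounded_symbol (truncate M m).
Proof.
move=> M0 mm; split; first exact: cmeasurable_truncate.
by exists M => y; rewrite /truncate; case: ifP => //; rewrite modulus0.
Qed.

Lemma ae_bounded m : Lp +oo%E m -> exists M, {ae mu, forall y, modulus (m y) <= M}.
Proof.
have mT : (0 < mu [set: R])%E.
  apply: (@lt_le_trans _ _ (mu `[0, 1]%classic)).
    by rewrite lebesgue_measure_itv /= lte_fin ltr01 oppr0 adde0 lte_fin ltr01.
  by apply: le_measure; rewrite ?inE.
move=> [_]; rewrite /Lp_norm.
have -> F : Lnorm mu +oo%E F = ess_sup mu (abse \o F) by rewrite unlock mT.
set F := (X in ess_sup mu X) => hoo.
have F0 : (0 <= ess_sup mu F)%E.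
  rewrite -(ess_sup_cst (0 : \bar R) mT); apply: le_ess_sup; apply: aeW => x /=.
  exact: abse_ge0.
have hE : ess_sup mu F = (fine (ess_sup mu F))%:E by rewrite fineK// ge0_fin_numE.
exists (fine (ess_sup mu F)); apply: ae_mono (ess_sup_ge mu F) => y.
by rewrite hE /F /= ger0_norm ?modulus_ge0.
Qed.

Lemma ae_eq_mult_op m m' f : cmeasurable m -> cmeasurable m' ->
  {ae mu, forall y, m y = m' y} -> test_fun f -> mult_op m f = mult_op m' f.
Proof.
move=> mm mm' E tf; have mF := csmooth_measurable (csmooth_fourier tf).
apply/funext => x; apply: ae_eq_cintegral.
- apply: cmeasurableM; first by apply: cmeasurable_expi; exact: measurable_scale.
  exact: cmeasurableM.
- apply: cmeasurableM; first by apply: cmeasurable_expi; exact: measurable_scale.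
  exact: cmeasurableM.
- by apply: ae_mono E => y ->.
Qed.

Lemma mult_opLp_congr (p : R) m m' f g : (forall f, test_fun f -> mult_op m f = mult_op m' f) ->
  mult_opLp p m f g -> mult_opLp p m' f g.
Proof.
move=> E [h1 h2 [f_ [h3 h4 h5]]]; split; [exact: h1|exact: h2|].
exists f_; split; [exact: h3|exact: h4|].
by under eq_fun do rewrite -E//.
Qed.

Lemma mult_norm_congr (p : R) m m' : (forall f, test_fun f -> mult_op m f = mult_op m' f) ->
  mult_norm p m = mult_norm p m' /\ mult_normR p m = mult_normR p m'.
Proof.
move=> E; have E' f : test_fun f -> mult_op m' f = mult_op m f by move=> tf; rewrite E.
split; apply: (congr1 (fun A => ereal_sup A)); apply/seteqP; split => r.
- move=> [f [g [h1 h2 h3]]]; exists f, g; split; [exact: (mult_opLp_congr E h1)|exact: h2|exact: h3].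
- move=> [f [g [h1 h2 h3]]]; exists f, g; split; [exact: (mult_opLp_congr E' h1)|exact: h2|exact: h3].
- move=> [f [g [h0 h1 h2 h3]]]; exists f, g; split; [exact: h0|exact: (mult_opLp_congr E h1)|exact: h2|exact: h3].
- move=> [f [g [h0 h1 h2 h3]]]; exists f, g; split; [exact: h0|exact: (mult_opLp_congr E' h1)|exact: h2|exact: h3].
Qed.

Lemma ccvg_eps (u : nat -> C) l :
  (forall e : R, 0 < e -> \forall n \near \oo, modulus (l - u n) < e) -> ccvg u l.
Proof.
move=> H; split; apply/cvgrPdist_lt => e e0; apply: filterS (H e e0) => n;
  apply: le_lt_trans.
  by rewrite -ReN -ReD normr_Re_le.
by rewrite -ImN -ImD normr_Im_le.
Qed.

Lemma normC_modulus (z : C) : `|z| = (modulus z)%:C.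
Proof. by rewrite normc_def modulusE. Qed.

Lemma continuous_near m (e : R) : {for (0 : R), continuous (m : R -> C^o)} ->
  0 < e -> \forall x \near (0 : R), modulus (m 0 - m x) < e.
Proof.
move=> cm e0; have ec : 0 < e%:C :> C by rewrite ltcR.
move/cvgrPdist_lt : cm => /(_ _ ec); apply: filterS => x.
by rewrite normC_modulus ltcR.
Qed.

Lemma truncate_scales (M : R) m : {for (0 : R), continuous (m : R -> C^o)} ->
  modulus (m 0) + 1 <= M -> continuous_along_scales (truncate M m).
Proof.
move=> cm hM y; have T0 : truncate M m 0 = m 0 by rewrite /truncate ifT//; lra.
rewrite T0; apply: ccvg_eps => e e0.
have u0 := @cvg_scale_seq R y.
have h1 : \forall n \near \oo, modulus (m 0 - m (scale_seq R n * y + 0)) < e.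
  exact: (u0 _ (continuous_near cm e0)).
have h2 : \forall n \near \oo, modulus (m 0 - m (scale_seq R n * y + 0)) < 1.
  exact: (u0 _ (continuous_near cm ltr01)).
apply: filterS2 h1 h2 => n /= h1 h2.
rewrite /truncate ifT//; apply: le_trans hM.
have -> : m (scale_seq R n * y + 0) = m 0 - (m 0 - m (scale_seq R n * y + 0)) by ring.
by apply: le_trans (ler_modulusD _ _) _; rewrite modulusN lerD2l ltW.
Qed.

End truncation.

(** * The two-sided estimates *)

Unset Implicit Arguments.

Theorem corollary4p4 (R : realType) (p : R) (m : R -> R[i]) :
  1 < p ->
  is_multiplier p m ->
  {for (0 : R), continuous (m : R -> (R[i])^o)} ->
  m 0 != 0 ->
  [/\ ((c_ p * (modulus (m 0))%:E <= mult_norm p (pos_part m))%E /\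
       (mult_norm p (pos_part m) <= c_ p * mult_norm p m)%E),
      (real_valued m -> even_fun m ->
       (cR_ p * (modulus (m 0))%:E <= mult_normR p (pos_part m))%E /\
       (mult_normR p (pos_part m) <= cR_ p * mult_norm p m)%E) &
      (forall h : R -> R[i],
         Lp 1%:E h ->
         {ae @lebesgue_measure R, forall x, 0 <= h x} ->
         fourier_is m h ->
         ((c_ p * (modulus (m 0))%:E = mult_norm p (pos_part m))%E /\
          (mult_norm p (pos_part m) = c_ p * mult_norm p m)%E) /\
         (real_valued m -> even_fun m ->
          (cR_ p * (modulus (m 0))%:E = mult_normR p (pos_part m))%E /\
          (mult_normR p (pos_part m) = cR_ p * mult_norm p m)%E))].
Proof.
move=> p1 [Lm _] cm mn0; have [mm _] := Lm.
have [M0 aeM] := ae_bounded Lm.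
(* The added 1 leaves room for the values of [m] near 0. *)
pose M := Num.max M0 (modulus (m 0) + 1); pose m' := truncate M m.
have hM : modulus (m 0) + 1 <= M by rewrite le_max lexx orbT.
have M_ge0 : 0 <= M by apply: le_trans hM; rewrite addr_ge0 ?modulus_ge0.
have aeE : {ae @lebesgue_measure R, forall y, m y = m' y}.
  apply: ae_mono aeM => y my; rewrite /m' /truncate ifT//.
  by rewrite le_max my.
have bm' : bounded_symbol m' by exact: truncate_bounded_symbol.
have mm' : cmeasurable m' by case: bm'.
have sm' : continuous_along_scales m' by exact: truncate_scales.
have m'0 : m' 0 = m 0 by rewrite /m' /truncate ifT//; lra.
have m'n0 : m' 0 != 0 by rewrite m'0.
have E f : test_fun f -> mult_op m f = mult_op m' f by exact: ae_eq_mult_op.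
have [ms _] := half_line_bounded_symbol R.
have Ep f : test_fun f -> mult_op (pos_part m) f = mult_op (pos_part m') f.
  apply: ae_eq_mult_op.
  - rewrite (_ : pos_part m = fun y => half_line y * m y); first exact: cmeasurableM.
    by apply/funext => y; rewrite pos_partE.
  - by case: (pos_part_bounded_symbol bm').
  - by apply: ae_mono aeE => y ym; rewrite !pos_partE ym.
have [-> _] := mult_norm_congr p E.
have [-> ->] := mult_norm_congr p Ep.
have lo := lower_bound p1 bm' sm' m'n0.
have up := upper_bound p1 bm'.
have loR := lower_boundR p1 bm' sm' m'n0.
rewrite m'0 in lo loR.
have upR : real_valued m -> even_fun m ->
    (mult_normR p (pos_part m') <= cR_ p * mult_norm p m')%E.
  move=> rm em; apply: (upper_boundR p1 bm') => y.
    by rewrite /m' /truncate; case: ifP.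
  by rewrite /m' /truncate em.
split; [by []|by move=> rm em; split; [|exact: upR]|].
move=> h Lh h0 mh.
have mh' : transform_on_tests m' h.
  move=> phi tphi; rewrite -(mh _ (test_fun_schwartz tphi)).
  have mphi := csmooth_measurable (csmooth_fourier tphi).
  apply: ae_eq_cintegral; do ?exact: cmeasurableM.
  by apply: ae_mono aeE => y ->.
have N := nonnegative_transform_norm p1 bm' sm' Lh h0 mh'; rewrite m'0 in N.
have bs := half_line_bounded_symbol R.
(* The chain of inequalities closes up once the norm of [m] is at most [|m 0|]. *)
have close (c n N' : \bar R) : (0 <= c -> c * (modulus (m 0))%:E <= N' ->
    N' <= c * n -> n <= (modulus (m 0))%:E ->
    c * (modulus (m 0))%:E = N' /\ N' = c * n)%E.
  move=> c0 h1 h2 h3; have h4 := lee_wpmul2l c0 h3.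
  split; apply/eqP; rewrite eq_le.
    by rewrite h1 (le_trans h2).
  by rewrite h2 (le_trans h4).
have c0 : (0 <= c_ p)%E by exact: (mult_norm_ge0 p1 bs).
have cR0 : (0 <= cR_ p)%E by exact: (mult_normR_ge0 p1 bs).
split; first exact: (close _ _ _ c0 lo up N).
by move=> rm em; exact: (close _ _ _ cR0 loR (upR rm em) N).
Qed.
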